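(* Let $V$ be a real vector space of finite dimension $N\ge 1$, let $A\subset V$ be a conic domain, and let $B\subset A$ be a subset such that, denoting by $S$ the boundary of $B$ in $A$, the following hold: (a1) $B$ is a closed subset of $A$ which intersects every direction $D_v=\{\lambda v:\lambda>0\}$, $v\in A$; (a2) $v\in B$ implies $\lambda v\in B$ for all $\lambda\in(0,1)$; (a3) $S$ is a smooth hypersurface and a closed subset of $A$ such that the position vector at each $v\in S$ is transversal to $S$ (i.e. $v\notin T_vS$); (a4) for each $v\in B\setminus\{0\}$ there exists a (necessarily unique) $\lambda>0$ such that $v/\lambda\in S$. Then the map $$\|\cdot\|_B:A\to\mathbb R,\qquad \|v\|_B=\inf\{\lambda>0: v/\lambda\in B\},$$ is a Minkowski conic pseudo-norm and its closed unit ball $\{v\in A:\|v\|_B\le 1\}$ is equal to $B$. Moreover: (i) $\|\cdot\|_B$ is a Minkowski pseudo-norm if and only if $S$ is homeomorphic to a sphere. In this case, $0$ belongs to the interior of $B$ and $\|\cdot\|_B$ is continuous at $0$. (ii) $\|\cdot\|_B$ is a Minkowski conic norm if and only if $S$ is strongly convex. Assume now that $A$ is convex. Then: (iii) $\|\cdot\|_B$ is a conic norm if and only if $B$ is convex, and if and only if $S$ is convex. (iv) $\|\cdot\|_B$ is a conic norm with strict triangle inequality if and only if $B$ is strictly convex, and if and only if $S$ is strictly convex.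
   Context: Smooth means $C^\infty$. A conic domain $A\subset V$ is a non-empty open subset such that $v\in A$ implies $\lambda v\in A$ for all $\lambda>0$; thus $0\in A$ only if $A=V$. Convention: if $V\setminus\{0\}\subset A$ then $A=V$ (so $0\notin A$ exactly when $A$ does not contain all nonzero vectors). For a map $\|\cdot\|:A\to\mathbb R$ consider: (positivity) $\|v\|\ge 0$ for all $v\in A$, with equality iff $v=0$; (positive homogeneity) $\|\lambda v\|=\lambda\|v\|$ for all $\lambda>0$, $v\in A$. A Minkowski conic pseudo-norm on $V$ is a map $\|\cdot\|:A\to\mathbb R$, $A$ a conic domain, which is positive, positively homogeneous and smooth on $A\setminus\{0\}$. It is a Minkowski pseudo-norm if $A=V$. Its fundamental tensor is $g_v(u,w)=\frac{\partial^2}{\partial t\partial s}\frac12\|v+tu+sw\|^2|_{t=s=0}$ for $v\in A\setminus\{0\}$, $u,w\in V$; it is a Minkowski conic norm if $g_v$ is positive definite for all $v\in A\setminus\{0\}$. When $A$ is convex, a positive and positively homogeneous map $\|\cdot\|:A\to\mathbb R$ is a conic norm if $\|v+w\|\le\|v\|+\|w\|$ for all $v,w\in A$; it is a conic norm with strict triangle inequality if, in addition, equality holds only if $v=\lambda w$ or $w=\lambda v$ for some $\lambda\ge0$. $B$ is convex if $u,v\in B$ implies $\lambda u+(1-\lambda)v\in B$ for all $\lambda\in[0,1]$; it is strictly convex if $u,v\in B$, $u\ne v$, implies that $\lambda u+(1-\lambda)v$ lies in the interior of $B$ for all $\lambda\in(0,1)$. With $\nabla^0$ the natural affine connection of $V$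 and $\xi$ a vector field along $S$ transverse to $S$ and pointing into the interior of $B$ (e.g. $\xi_v=-v$), the second fundamental form $\sigma^\xi$ of $S$ is defined, for $X,Y$ tangent to $S$, by $\nabla^0_XY=\nabla^\xi_XY+\sigma^\xi(X,Y)\xi$ with $\nabla^\xi_XY$ tangent to $S$. $S$ is strongly convex if $\sigma^\xi$ is positive definite, and convex if $\sigma^\xi$ is positive semi-definite (both conditions do not depend on the choice of such $\xi$; in particular one may use the inner normal for an auxiliary Euclidean product). $S$ is strictly convex if the affine hyperplane tangent to $S$ at each $v_0\in S$ touches $B$ only at $v_0$. *)

(* Defs.v *)
From HB Require Import structures.
From mathcomp Require Import all_boot all_order all_algebra.
From mathcomp Require Import all_classical all_reals all_analysis.

Set Implicit Arguments.
Unset Strict Implicit.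
Unset Printing Implicit Defensive.

Import Order.TTheory GRing.Theory Num.Theory.
Import numFieldNormedType.Exports.

Local Open Scope classical_set_scope.
Local Open Scope ring_scope.

(* A finite-dimensional real vector space is a [normedModType] that is linearly
   isomorphic to R^N: its norm is auxiliary and only provides the natural
   topology of the space.
   A map with domain A, a subset of V, is a total function on V whose values
   outside A are irrelevant. *)

Definition has_dimension (R : realType) (N : nat) (V : normedModType R) : Prop :=
  exists phi : {linear 'rV[R]_N -> V}, bijective phi.

Section Smooth.
Context {R : realType}.

Fixpoint iter_derive {E F : normedModType R} (l : seq E) (f : E -> F) : E -> F :=
  if l is v :: l' then 'D_v (iter_derive l' f) else f.

(* C^oo on U, for U open: the iterated directional derivatives of all orders
   are (Frechet) differentiable at every point of U. *)
Definition smooth_on {E F : normedModType R} (U : set E) (f : E -> F) : Prop :=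
  forall (l : seq E) (x : E), U x -> differentiable (iter_derive l f) x.

Definition diffeomorphism_between {E F : normedModType R} (U : set E)
    (W : set F) (f : E -> F) : Prop :=
  exists g : F -> E,
    [/\ smooth_on U f, smooth_on W g,
        (forall x, U x -> W (f x) /\ g (f x) = x)
      & (forall y, W y -> U (g y) /\ f (g y) = y)].

(* Embedded hypersurface: around each point of S there is a chart of V that
   sends S to a coordinate hyperplane of R^N. *)
Definition smooth_hypersurface {V : normedModType R} (N : nat) (S : set V)
    : Prop :=
  forall p, S p ->
    exists (U : set V) (W : set 'rV[R]_N) (f : V -> 'rV[R]_N) (i : 'I_N),
      [/\ open U, U p, open W, diffeomorphism_between U W f
        & forall q, U q -> (S q <-> f q ord0 i = 0)].

(* T_p S: velocities at p of the smooth curves contained in S. *)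
Definition tangent_space {V : normedModType R} (S : set V) (p : V) : set V :=
  [set u | exists (e : R) (c : R -> V),
      [/\ 0 < e, smooth_on [set t : R | `|t| < e] c,
          (forall t, `|t| < e -> S (c t)), c 0 = p & derive1 c 0 = u]].

(* Smooth vector fields along S, given near each point of S by a smooth map on
   a neighbourhood in V. *)
Definition smooth_along {V : normedModType R} (S : set V) (xi : V -> V) : Prop :=
  forall p, S p -> exists (U : set V) (X : V -> V),
    [/\ open U, U p, smooth_on U X & forall q, U q -> S q -> X q = xi q].

Definition tangent_field_near {V : normedModType R} (S : set V) (p : V)
    (Y : V -> V) : Prop :=
  exists U : set V,
    [/\ open U, U p, smooth_on U Y
      & forall q, U q -> S q -> tangent_space S q (Y q)].

(* sigma^xi_p(x, y) for x, y in T_p S: the coefficient s of xi in the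
   decomposition nabla^0_x Y = Z + s xi with Z tangent, where Y is a tangent
   field extending y and nabla^0 is the directional derivative of V.  For a
   hypersurface S and xi transverse to it, s exists and does not depend on Y. *)
Definition second_fundamental_form {V : normedModType R} (S : set V)
    (xi : V -> V) (p x y : V) : R :=
  xget 0 [set s | exists Y Z : V -> V,
    [/\ tangent_field_near S p Y, Y p = y, tangent_space S p (Z p)
      & 'D_x Y p = Z p + s *: xi p]].

Definition inward_transverse_field {V : normedModType R} (B S : set V)
    (xi : V -> V) : Prop :=
  smooth_along S xi /\
  forall v, S v -> ~ tangent_space S v (xi v) /\
    exists2 e : R, 0 < e & forall t, 0 < t < e -> interior B (v + t *: xi v).

Definition strongly_convex_hypersurface {V : normedModType R} (S : set V)
    (xi : V -> V) : Prop :=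
  forall v, S v -> forall x, tangent_space S v x -> x != 0 ->
    0 < second_fundamental_form S xi v x x.

Definition convex_hypersurface {V : normedModType R} (S : set V)
    (xi : V -> V) : Prop :=
  forall v, S v -> forall x, tangent_space S v x ->
    0 <= second_fundamental_form S xi v x x.

Definition strictly_convex_hypersurface {V : normedModType R} (B S : set V)
    : Prop :=
  forall v0, S v0 -> [set v0 + u | u in tangent_space S v0] `&` B = [set v0].

End Smooth.

Section Sets.
Context {R : realType} {V : normedModType R}.
Implicit Types A B : set V.

(* The last condition is the convention that V \ {0} is not a conic domain. *)
Definition conic_domain A : Prop :=
  [/\ A !=set0, open A, (forall v (l : R), A v -> 0 < l -> A (l *: v))
    & ((forall v, v != 0 -> A v) -> A 0)].

Definition boundary_in A B : set V := A `&` closure B `&` closure (A `\` B).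

Definition strictly_convex_set B : Prop :=
  forall u v, B u -> B v -> u != v ->
    forall l : R, 0 < l < 1 -> interior B (l *: u + (1 - l) *: v).

End Sets.

Section Norms.
Context {R : realType} {V : normedModType R}.
Implicit Types (A B : set V) (F : V -> R).

Definition positive_on A F : Prop :=
  forall v, A v -> 0 <= F v /\ (F v = 0 <-> v = 0).

Definition positively_homogeneous_on A F : Prop :=
  forall v (l : R), A v -> 0 < l -> F (l *: v) = l * F v.

Definition minkowski_conic_pseudo_norm A F : Prop :=
  [/\ conic_domain A, positive_on A F, positively_homogeneous_on A F
    & smooth_on (A `\ 0) F].

Definition minkowski_pseudo_norm A F : Prop :=
  minkowski_conic_pseudo_norm A F /\ A = setT.

Definition fundamental_tensor F (v u w : V) : R :=
  derive1 (fun t : R =>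
    derive1 (fun s : R => 2^-1 * F (v + t *: u + s *: w) ^+ 2) 0) 0.

Definition minkowski_conic_norm A F : Prop :=
  minkowski_conic_pseudo_norm A F /\
  forall v, A v -> v != 0 -> forall u, u != 0 -> 0 < fundamental_tensor F v u u.

Definition conic_norm A F : Prop :=
  [/\ conic_domain A, convex_set A, positive_on A F,
      positively_homogeneous_on A F
    & forall v w, A v -> A w -> F (v + w) <= F v + F w].

Definition conic_norm_strict A F : Prop :=
  conic_norm A F /\
  forall v w, A v -> A w -> F (v + w) = F v + F w ->
    exists2 l : R, 0 <= l & v = l *: w \/ w = l *: v.

Definition gauge B (v : V) : R := inf [set l : R | 0 < l /\ B (l^-1 *: v)].

End Norms.

Section Spheres.

Definition homeomorphic_sets {X Y : topologicalType} (S : set X) (T : set Y)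
    : Prop :=
  exists (f : X -> Y) (g : Y -> X),
    [/\ {within S, continuous f}, {within T, continuous g},
        (forall x, S x -> T (f x) /\ g (f x) = x)
      & (forall y, T y -> S (g y) /\ f (g y) = y)].

(* The norm of 'rV[R]_N in the library is the sup norm, hence the explicit
   sum of squares. *)
Definition euclidean_sphere (R : realType) (N : nat) : set 'rV[R]_N :=
  [set x | \sum_(i < N) x ord0 i ^+ 2 = 1].

End Spheres.

(* Main.v *)
(** Every ray of A meets S exactly once: near v in S a local equation h of S
    satisfies dh_v(v) <> 0 because v is transverse to S, so a small ball
    around a point (1 + s) v misses S and hence lies entirely inside or
    entirely outside B; as v is a limit of points outside B and B is
    star-shaped, it lies outside.  Therefore v / F v is in S for the gauge F of
    B, and solving h (v / F v) = 0 for F v shows that F is smooth, with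
    D_u F (v) = D_u h (p) / D_p h (p) at p = v / F v.

    From then on S = {F = 1}, T_p S = ker dF_p, and differentiating
    dF(Y) = 0 for a tangent field Y shows that the second fundamental form is a
    positive multiple of the Hessian of F on T_p S.  Since
    g_v(u, u) = dF_v(u)^2 + F v * Hess F_v(u, u) and v is in the kernel of
    Hess F_v, this gives (ii).  For (iii) and (iv) the pivot is the inequality
    dF_x(y) <= F y, which is equivalent both to the triangle inequality
    (apply it at x = v + w, where dF_x(x) = F x) and to Hess F >= 0; the
    hyperplane tangent to S at p is {dF_p = 1}.  For (i), if S is compact then A
    is open and relatively closed in V \ {0}. *)

Require Import Defs.
From HB Require Import structures.
From mathcomp Require Import all_boot all_order all_algebra.
From mathcomp Require Import all_classical all_reals all_analysis.
From mathcomp Require Import ring lra.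

Set Implicit Arguments.
Unset Strict Implicit.
Unset Printing Implicit Defensive.

Import Order.TTheory GRing.Theory Num.Theory.
Import numFieldNormedType.Exports.

Local Open Scope classical_set_scope.
Local Open Scope ring_scope.

(** * Maps of finite order of smoothness *)

Section Differentiability.
Context {R : realType} {E F : normedModType R}.

(** Regularity is gained one order at a time. The formula for dF involves only derivatives of h at v
    / F v, hence F itself, so order n of F gives order n of every D_u F and therefore order n + 1 of
    F. No implicit function has to be constructed: F exists beforehand as an infimum, its continuity
    comes from the openness of A minus B and of the interior of B, and the local equation only
    serves to linearize it. Two places resist. In (i), the complement of the origin is connected
    only for N >= 2; for N = 1 it is the two points of the sphere, sent to distinct points of S,
    that provide both rays. *)

Lemma differentiable_eps (f : E -> F) (df : {linear E -> F}) x :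
  continuous df ->
  (forall e, 0 < e -> \forall h \near 0, `|f (h + x) - f x - df h| <= e * `|h|) ->
  differentiable f x /\ 'd f x = df :> (E -> F).
Proof.
move=> dfc H.
have K : f \o shift x = cst (f x) + df +o_ 0 id.
  apply/eqaddoP => e e0; have := H e e0; apply: filterS => h /=.
  by rewrite opprD addrA.
have D := diff_unique dfc K; split => //.
by apply/diff_locallyP; rewrite D.
Qed.

Lemma differentiable_eps_exp (f : E -> F) x : differentiable f x ->
  forall e, 0 < e ->
    \forall h \near 0, `|f (h + x) - f x - 'd f x h| <= e * `|h|.
Proof.
move=> /diff_locallyP[_ /eqaddoP K] e e0; have := K e e0; apply: filterS => h /=.
by rewrite opprD addrA.
Qed.

Lemma near_eq_differentiable (f g : E -> F) x :
  (\near x, f x = g x) -> differentiable f x ->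
  differentiable g x /\ 'd g x = 'd f x :> (E -> F).
Proof.
move=> fg df; apply: differentiable_eps; first exact: diff_continuous.
move=> e e0; have := differentiable_eps_exp df e0.
have fg' : \forall h \near 0, f (h + x) = g (h + x).
  by have := fg; rewrite (near_shift 0 x) subr0.
apply: filterS2 fg' => h <-.
by rewrite (nbhs_singleton fg).
Qed.

End Differentiability.

Section FiniteSmoothness.
Context {R : realType}.

(* Derivatives of order n are again required to be differentiable, so [Ck n]
   lies between C^n and C^(n+1). *)
Definition Ck {E F : normedModType R} n (U : set E) (f : E -> F) : Prop :=
  forall l : seq E, (size l <= n)%N ->
    forall x, U x -> differentiable (iter_derive l f) x.

Lemma smooth_onP {E F : normedModType R} (U : set E) (f : E -> F) :
  smooth_on U f <-> forall n, Ck n U f.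
Proof.
split=> [sf n l _ x Ux|cf l x Ux]; first exact: sf.
exact: (cf (size l)).
Qed.

Lemma iter_derive_rcons {E F : normedModType R} (l : seq E) v (f : E -> F) :
  iter_derive (rcons l v) f = iter_derive l ('D_v f).
Proof. by elim: l => //= w l ->. Qed.

Lemma open_near {T : topologicalType} (U : set T) (P : T -> Prop) x :
  open U -> U x -> (forall y, U y -> P y) -> \near x, P x.
Proof.
by move=> oU Ux UP; apply: filterS UP _; exact: open_nbhs_nbhs.
Qed.

Section General.
Context {E F : normedModType R}.
Implicit Types (U : set E) (f g : E -> F).

Lemma iter_derive_ext U f g l : open U -> (forall x, U x -> f x = g x) ->
  forall x, U x -> iter_derive l f x = iter_derive l g x.
Proof.
move=> oU fg; elim: l => //= v l IH x Ux.
by apply: near_eq_derive; exact: (open_near oU).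
Qed.

Lemma Ck_ext n U f g : open U -> (forall x, U x -> f x = g x) ->
  Ck n U f -> Ck n U g.
Proof.
move=> oU fg cf l ln x Ux.
suff H : \near x, iter_derive l f x = iter_derive l g x.
  exact: (near_eq_differentiable H (cf l ln x Ux)).1.
by apply: (open_near oU Ux); exact: iter_derive_ext.
Qed.

Lemma Ck_diff n U f x : Ck n U f -> U x -> differentiable f x.
Proof. by move=> cf Ux; exact: (cf [::]). Qed.

(** [iter_derive] applies the last entry of its list first, so splitting that entry off with [rcons]
    isolates a first derivative. Most closure properties of [Ck] are inductions on the order through
    this equivalence. *)
Lemma CkS n U f : Ck n.+1 U f <->
  (forall x, U x -> differentiable f x) /\ forall v, Ck n U ('D_v f).
Proof.
split=> [cf|[df cf]].
  split=> [x|v l ln x Ux]; first exact: Ck_diff cf.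
  by rewrite -iter_derive_rcons; apply: cf => //; rewrite size_rcons.
elim/last_ind => [_ x|l v _ /=]; first exact: df.
by rewrite size_rcons => ln x Ux; rewrite iter_derive_rcons; exact: cf.
Qed.

Lemma Ck_le m n U f : (m <= n)%N -> Ck n U f -> Ck m U f.
Proof. by move=> mn cf l lm; apply: cf; exact: leq_trans lm mn. Qed.

Lemma CkW n U f : Ck n.+1 U f -> Ck n U f.
Proof. exact: Ck_le. Qed.

Lemma Ck_sub n U U' f : U' `<=` U -> Ck n U f -> Ck n U' f.
Proof. by move=> UU' cf l ln x /UU'; exact: cf. Qed.

Lemma Ck_cst n U (a : F) : Ck n U (cst a : E -> F).
Proof.
elim: n a => [|n IH] a.
  by move=> [|//] _ x _; exact: differentiable_cst.
apply/CkS; split=> [x _|v]; first exact: differentiable_cst.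
have -> : 'D_v (cst a : E -> F) = cst 0 by apply/funext => x; rewrite derive_cst.
exact: IH.
Qed.

Lemma Ck0 U f : (forall x, U x -> differentiable f x) -> Ck 0 U f.
Proof. by move=> df [|//] _; exact: df. Qed.

Lemma CkD n U f g : open U -> Ck n U f -> Ck n U g -> Ck n U (f + g).
Proof.
move=> oU; elim: n f g => [|n IH] f g cf cg.
  apply: Ck0 => x Ux; apply: differentiableD; [exact: Ck_diff cf _|exact: Ck_diff cg _].
apply/CkS; split=> [x Ux|v].
  by apply: differentiableD; [exact: Ck_diff cf _|exact: Ck_diff cg _].
move: (cf) (cg) => /CkS[df cdf] /CkS[dg cdg].
apply: Ck_ext (IH _ _ (cdf v) (cdg v)) => // x Ux.
by rewrite deriveD//; apply: diff_derivable; [exact: df|exact: dg].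
Qed.

Lemma Ck_sum n U (I : eqType) (r : seq I) (f : I -> E -> F) : open U ->
  (forall i, Ck n U (f i)) -> Ck n U (fun x => \sum_(i <- r) f i x).
Proof.
move=> oU cf; elim: r => [|i r IH].
  by apply: Ck_ext (@Ck_cst n U 0) => // x _; rewrite big_nil.
apply: Ck_ext (CkD oU (cf i) IH) => // x _.
by rewrite big_cons.
Qed.

Lemma Ck_lin n U (L : {linear E -> F}) : continuous L -> Ck n U L.
Proof.
move=> cL; case: n => [|n].
  by apply: Ck0 => x _; exact: linear_differentiable.
apply/CkS; split=> [x _|v]; first exact: linear_differentiable.
have -> : 'D_v L = cst (L v).
  apply/funext => x; rewrite deriveE; last exact: linear_differentiable.
  by rewrite diff_lin.
exact: Ck_cst.
Qed.

End General.

Section LinearComposition.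
Context {E F : normedModType R}.
Implicit Types (U : set E) (f g : E -> F).

Lemma Ck_post {G : normedModType R} n U f (L : {linear F -> G}) :
  open U -> continuous L -> Ck n U f -> Ck n U (L \o f).
Proof.
move=> oU cL; elim: n f => [|n IH] f cf.
  apply: Ck0 => x Ux; apply: differentiable_comp; first exact: Ck_diff cf _.
  exact: linear_differentiable.
apply/CkS; split=> [x Ux|v].
  apply: differentiable_comp; first exact: Ck_diff cf _.
  exact: linear_differentiable.
move: (cf) => /CkS[df cdf].
apply: Ck_ext (IH _ (cdf v)) => // x Ux /=.
have Lx : differentiable L (f x) by exact: linear_differentiable.
rewrite [RHS]deriveE; last by apply: differentiable_comp Lx; exact: df.
by rewrite diff_comp//=; [rewrite diff_lin// deriveE//; exact: df|exact: df].
Qed.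

(** The differential [L] of [a] is the same at every point, as for t |-> q + t w. The direction
    [L v] is then constant, so the induction needs no coordinates and the target can be any normed
    space. *)
Lemma Ck_pre {G : normedModType R} n (a : G -> E) (L : G -> E) U f :
  (forall x, is_diff x a L) -> open (a @^-1` U) -> Ck n U f ->
  Ck n (a @^-1` U) (f \o a).
Proof.
move=> da oU; elim: n f => [|n IH] f cf.
  apply: Ck0 => x Ux; apply: differentiable_comp; last exact: Ck_diff cf _.
  by have [] := da x.
have df x : (a @^-1` U) x -> differentiable (f \o a) x.
  move=> Ux; apply: differentiable_comp; last exact: Ck_diff cf _.
  by have [] := da x.
apply/CkS; split=> // v.
move: (cf) => /CkS[df' cdf].
apply: Ck_ext (IH _ (cdf (L v))) => // x Ux /=.
have [dax eax] := da x.
rewrite [RHS]deriveE; last exact: df.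
rewrite diff_comp//=; last exact: df'.
by rewrite eax deriveE//; exact: df'.
Qed.

End LinearComposition.

Section Scalar.
Context {E : normedModType R}.
Implicit Types (U : set E) (f g : E -> R).

Lemma CkM n U f g : open U -> Ck n U f -> Ck n U g ->
  Ck n U (fun x => f x * g x).
Proof.
move=> oU; elim: n f g => [|n IH] f g cf cg.
  by apply: Ck0 => x Ux; apply: differentiableM; [exact: Ck_diff cf _|exact: Ck_diff cg _].
move: (cf) (cg) => /CkS[df cdf] /CkS[dg cdg].
apply/CkS; split=> [x Ux|v].
  by apply: differentiableM; [exact: df|exact: dg].
have := CkD oU (IH _ _ (CkW cf) (cdg v)) (IH _ _ (CkW cg) (cdf v)).
apply: Ck_ext => // x Ux.
rewrite [RHS](@deriveM _ _ f g)//; apply: diff_derivable; [exact: df|exact: dg].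
Qed.

(** D_v (1/f) = - f^-2 D_v f involves only 1/f and D_v f, which are available at the lower order. *)
Lemma CkV n U f : open U -> (forall x, U x -> f x != 0) -> Ck n U f ->
  Ck n U (fun x => (f x)^-1).
Proof.
move=> oU f0; elim: n => [|n IH] cf.
  by apply: Ck0 => x Ux; apply: differentiableV; [exact: Ck_diff cf _|exact: f0].
move: (cf) => /CkS[df cdf].
apply/CkS; split=> [x Ux|v]; first by apply: differentiableV; [exact: df|exact: f0].
have IH' := IH (CkW cf).
have := CkM oU (CkM oU (CkM oU IH' IH') (cdf v)) (Ck_cst (F := R) (-1) (U := U) (n := n)).
apply: Ck_ext => // x Ux.
rewrite [RHS](@deriveV _ _ f)//=; [|exact: f0|exact/diff_derivable/df].
by rewrite -[LHS]/(_ * -1) mulrN1 scaleNr -exprVn.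
Qed.

End Scalar.
End FiniteSmoothness.

(** * Finite dimension: continuity of linear maps, continuous coordinates *)

Section FiniteDimension.
Context {R : realType}.

Lemma linear_norm_bounded_continuous {E F : normedModType R} (f : {linear E -> F}) M :
  (forall x, `|f x| <= M * `|x|) -> continuous f.
Proof.
move=> fM; apply: continuousfor0_continuous.
apply/cvgrPdist_le => e e0.
have M0 : 0 < `|M| + 1 by rewrite ltr_wpDl.
near=> x; rewrite linear0 sub0r normrN (le_trans (fM x))//.
rewrite (@le_trans _ _ ((`|M| + 1) * `|x|))//.
  by rewrite ler_wpM2r// (le_trans (ler_norm M))// lerDl.
rewrite mulrC -ler_pdivlMr//; near: x.
apply/nbhs_normP; exists (e / (`|M| + 1)); first by rewrite /= divr_gt0.
by move=> x /=; rewrite sub0r normrN => /ltW.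
Unshelve. all: by end_near. Qed.

Lemma linear_rV_continuous {V : normedModType R} N (f : {linear 'rV[R]_N -> V}) :
  continuous f.
Proof.
apply: (@linear_norm_bounded_continuous _ _ f (\sum_i `|f (delta_mx 0 i)|)) => x.
rewrite {1}(row_sum_delta x) linear_sum mulr_suml.
apply: le_trans (ler_norm_sum _ _ _) _; apply: ler_sum => i _.
rewrite linearZ normrZ mulrC ler_wpM2l//.
rewrite [leRHS]/Num.norm /= mx_normrE.
by apply: (le_trans _ (le_bigmax _ _ (ord0, i))).
Qed.

Lemma unit_sphere_compact N : compact [set x : 'rV[R]_N | `|x| = 1].
Proof.
apply: bounded_closed_compact.
  by exists 1; split=> // M M1 x /= ->; exact: ltW.
apply: (preimage_closed (f := fun x : 'rV[R]_N => `|x|) (D := [set 1])).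
  by move=> x _; exact: norm_continuous.
exact: closed_eq.
Qed.

(** By injectivity, |f| has a positive minimum on the compact unit sphere of R^N; by homogeneity its
    reciprocal bounds [g]. *)
Lemma rV_linear_continuous {V : normedModType R} N (f : {linear 'rV[R]_N -> V})
  (g : {linear V -> 'rV[R]_N}) : cancel f g -> cancel g f -> continuous g.
Proof.
move=> fK gK.
(* In the zero space the unit sphere is empty and has no minimum. *)
have [[x0 x0N]|N0] := pselect (exists x : 'rV[R]_N, x != 0); last first.
  apply: (@linear_norm_bounded_continuous _ _ g 0) => v.
  suff -> : g v = 0 by rewrite normr0 mul0r.
  by apply/eqP/negP => /negP gv; apply: N0; exists (g v).
pose K := [set x : 'rV[R]_N | `|x| = 1].
have cK : compact K := @unit_sphere_compact N.
have [|||c /= Kc cmin] := @EVT_min_rV R N (fun x => `|f x|) K.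
- by exists (`|x0|^-1 *: x0); rewrite /K /= normrZ normfV normr_id mulVf ?normr_eq0.
- by [].
- apply: continuous_subspaceT => x; apply: continuous_comp.
    exact: linear_rV_continuous.
  exact: norm_continuous.
have m0 : 0 < `|f c|.
  rewrite normr_gt0; apply/eqP => fc0; have := fK c; rewrite fc0 linear0 => c0.
  by move: Kc; rewrite /K inE /= -c0 normr0 => /esym/eqP; rewrite oner_eq0.
apply: (@linear_norm_bounded_continuous _ _ g `|f c|^-1) => v.
have [->|gv0] := eqVneq (g v) 0; first by rewrite normr0 mulr_ge0 ?invr_ge0.
rewrite mulrC ler_pdivlMr// mulrC.
have gvp : 0 < `|g v| by rewrite normr_gt0.
have := cmin (`|g v|^-1 *: g v); rewrite inE /K /= normrZ normfV normr_id mulVf ?gt_eqF//.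
move=> /(_ erefl); rewrite linearZ /= gK normrZ normfV normr_id.
by rewrite mulrC ler_pdivlMr.
Qed.

Lemma has_dimension_coord (N : nat) (V : normedModType R) : has_dimension N V ->
  exists (phi : {linear 'rV[R]_N -> V}) (psi : {linear V -> 'rV[R]_N}),
    [/\ cancel phi psi, cancel psi phi, continuous phi & continuous psi].
Proof.
move=> [phi [g phiK gK]].
pose gL := GRing.isLinear.Build _ _ _ _ _ (can2_linear phiK gK).
pose psi : {linear V -> 'rV[R]_N} := HB.pack g gL.
exists phi, psi; split => //; first exact: linear_rV_continuous.
exact: (@rV_linear_continuous _ _ phi).
Qed.

(** Used to rewrite a derivative along a direction that varies with the point as a combination of
    derivatives along the fixed [b i]. *)
Definition coordinates (V : normedModType R) N (b : 'I_N -> V)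
    (psi : 'I_N -> {linear V -> R}) : Prop :=
  (forall i, continuous (psi i)) /\ forall v, v = \sum_i psi i v *: b i.

Lemma has_coordinates (N : nat) (V : normedModType R) : has_dimension N V ->
  exists (b : 'I_N -> V) (psi : 'I_N -> {linear V -> R}), coordinates b psi.
Proof.
move=> /has_dimension_coord[phi [psi [phiK psiK cphi cpsi]]].
have L i : linear (fun v => psi v ord0 i : R).
  by move=> a u v; rewrite linearP !mxE.
pose c i : {linear V -> R} := HB.pack (fun v => psi v ord0 i : R)
  (GRing.isLinear.Build _ _ _ _ _ (L i)).
exists (fun i => phi (delta_mx 0 i)), c; split=> [i v|v].
  apply: (@continuous_comp _ _ _ psi (fun x : 'rV[R]_N => x ord0 i)); first exact: cpsi.
  exact: coord_continuous.
rewrite -{1}(psiK v) {1}(row_sum_delta (psi v)) linear_sum.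
by apply: eq_bigr => i _; rewrite linearZ.
Qed.

End FiniteDimension.

Section Composition.
Context {R : realType} {N : nat} {V E : normedModType R}.
Variables (b : 'I_N -> V) (psi : 'I_N -> {linear V -> R}).
Hypothesis bpsi : coordinates b psi.

Lemma derive_coord (h : V -> R) x v : differentiable h x ->
  'D_v h x = \sum_i psi i v * 'D_(b i) h x.
Proof.
move=> dh; rewrite deriveE// {1}(bpsi.2 v) linear_sum.
by apply: eq_bigr => i _; rewrite linearZ /= deriveE.
Qed.

(** Chain rule: the derivative of h o G is that of h along D_v G x, a direction depending on x.
    Expanding this direction in coordinates leaves products of functions to which the induction
    applies. *)
Lemma Ck_comp n (U : set E) (W : set V) (G : E -> V) (h : V -> R) :
  open U -> (forall x, U x -> W (G x)) -> Ck n U G -> Ck n W h ->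
  Ck n U (h \o G).
Proof.
move=> oU UW; elim: n h => [|n IH] h cG ch.
  apply: Ck0 => x Ux; apply: differentiable_comp; first exact: Ck_diff cG _.
  exact/(Ck_diff ch)/UW.
move: (cG) (ch) => /CkS[dG cdG] /CkS[dh cdh].
have dhG x : U x -> differentiable (h \o G) x.
  by move=> Ux; apply: differentiable_comp; [exact: dG|exact/dh/UW].
apply/CkS; split=> // v.
have K i : Ck n U (fun x => (psi i \o 'D_v G) x * ('D_(b i) h \o G) x).
  apply: CkM => //; first by apply: Ck_post => //; exact: bpsi.1.
  by apply: IH => //; exact: CkW.
apply: Ck_ext (Ck_sum (index_enum 'I_N) oU K) => // x Ux /=.
rewrite -derive_coord; last exact/dh/UW.
rewrite [RHS]deriveE; last exact: dhG.
rewrite diff_comp//=; [|exact: dG|exact/dh/UW].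
rewrite deriveE; last exact/dh/UW.
by rewrite deriveE//; exact: dG.
Qed.

Lemma Ck_scale n (U : set E) (k : E -> R) (g : E -> V) :
  open U -> Ck n U k -> Ck n U g -> Ck n U (fun x => k x *: g x).
Proof.
move=> oU ck cg.
have L i : linear (fun a : R => a *: b i).
  by move=> a u v; rewrite scalerDl scalerA.
pose c i : {linear R -> V} := HB.pack (fun a : R => a *: b i)
  (GRing.isLinear.Build _ _ _ _ _ (L i)).
have K i : Ck n U (c i \o (fun x => k x * (psi i \o g) x)).
  apply: Ck_post => //; first exact: scalel_continuous.
  apply: CkM => //; apply: Ck_post => //; exact: bpsi.1.
apply: Ck_ext (Ck_sum (index_enum 'I_N) oU K) => // x Ux /=.
rewrite [in RHS](bpsi.2 (g x)) scaler_sumr.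
by apply: eq_bigr => i _; rewrite scalerA.
Qed.

End Composition.

(** * Lines, segments and curves *)

Section Curves.
Context {R : realType}.

Lemma is_diff_line {V : normedModType R} (q w : V) (t : R) :
  is_diff t (fun s : R => q + s *: w) (fun s : R => s *: w).
Proof.
have D : is_diff t (cst q + ( *:%R ^~ w)) (0 + ( *:%R ^~ w)) by exact: is_diffD.
apply: is_diff_eq D _.
by apply/funext => s; rewrite -[LHS]/(0 + _) add0r.
Qed.

Lemma line_continuous {V : normedModType R} (q w : V) :
  continuous (fun s : R => q + s *: w).
Proof.
move=> s; apply: cvgD; first exact: cvg_cst.
exact: scalel_continuous.
Qed.

Lemma open_punctured {V : normedModType R} (A : set V) : open A -> open (A `\ 0).
Proof.
move=> oA; rewrite setDE; apply: openI => //; apply: closed_openC.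
exact/accessible_closed_set1/hausdorff_accessible/norm_hausdorff.
Qed.

Lemma near_line {V : normedModType R} (q w : V) (O : set V) : open O -> O q ->
  exists2 e : R, 0 < e & forall t, `|t| < e -> O (q + t *: w).
Proof.
move=> oO Oq.
have : nbhs (0 : R) ((fun s : R => q + s *: w) @^-1` O).
  apply: line_continuous; rewrite scale0r addr0; exact: open_nbhs_nbhs.
move=> /nbhs_normP[e /= e0 He]; exists e => // t te.
by apply: He; rewrite /= sub0r normrN.
Qed.

(** Connectedness of [0, 1]: along the segment, membership in [Y] is an open condition through [O]
    and a closed one through [C]. It serves for [B] inside a ball avoiding S, and for [A] away from
    the origin. *)
Lemma segment_clopen {V : normedModType R} (x w : V) (Y O C : set V) :
  open O -> closed C ->
  (forall t : R, 0 <= t <= 1 -> Y (x + t *: w) -> O (x + t *: w)) ->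
  (forall t : R, 0 <= t <= 1 -> O (x + t *: w) -> Y (x + t *: w)) ->
  (forall t : R, 0 <= t <= 1 -> (Y (x + t *: w) <-> C (x + t *: w))) ->
  Y x -> Y (x + w).
Proof.
move=> oO cC YO OY YC Yx.
pose g := fun t : R => x + t *: w.
have := @segment_connected R 0 1 (`[0, 1] `&` g @^-1` Y).
have i0 : (`[0, 1]%classic : set R) 0 by rewrite /= in_itv /= lexx ler01.
have i1 : (`[0, 1]%classic : set R) 1 by rewrite /= in_itv /= lexx ler01.
have H : (`[0, 1] `&` g @^-1` Y = `[0, 1])%classic -> Y (x + w).
  by move=> E; have : (`[0, 1] `&` g @^-1` Y)%classic 1;
     [rewrite E|move=> [_]; rewrite /= /g scale1r].
move=> K; apply/H/K.
- by exists 0; split => //=; rewrite /g scale0r addr0.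
- exists (g @^-1` O); first by apply: open_comp => // t _; exact: line_continuous.
  apply/seteqP; split=> t [ti] Yt; split => //;
  move: ti; rewrite /= in_itv /= => ti; [exact: YO|exact: OY].
- exists (g @^-1` C); first by apply: preimage_closed => // t _; exact: line_continuous.
  apply/seteqP; split=> t [ti] Yt; split => //;
  by move: ti; rewrite /= in_itv /= => /YC[? ?]; auto.
Qed.

Lemma smooth_curve {V W : normedModType R} (q w : V) (O : set V) (g : V -> W) :
  open O -> smooth_on O g ->
  smooth_on [set t : R | O (q + t *: w)] (fun t : R => g (q + t *: w)).
Proof.
move=> oO /smooth_onP sg; apply/smooth_onP => n.
have oU : open ((fun t : R => q + t *: w) @^-1` O).
  by apply: open_comp => // t _; exact: line_continuous.
exact: (Ck_pre (is_diff_line q w) oU (sg n)).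
Qed.

Lemma smooth_onS {V W : normedModType R} (U U' : set V) (f : V -> W) :
  U' `<=` U -> smooth_on U f -> smooth_on U' f.
Proof. by move=> UU sf l x /UU; exact: sf. Qed.

Lemma derive1_line {V W : normedModType R} (q w : V) (g : V -> W) :
  differentiable g q -> derive1 (fun t : R => g (q + t *: w)) 0 = 'D_w g q.
Proof.
move=> dg; have [da ea] := is_diff_line q w 0.
have dg' : differentiable g (q + 0 *: w) by rewrite scale0r addr0.
rewrite derive1E' ?(diff_comp (g := g) da dg')//=; last exact: differentiable_comp.
by rewrite ea scale1r scale0r addr0 deriveE.
Qed.

End Curves.

(** * The gauge of a star-shaped set with transverse smooth boundary *)

Section StarBody.
Context {R : realType} {N : nat} {V : normedModType R} {A B : set V}.
Hypothesis conicA : conic_domain A.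
Hypothesis BA : B `<=` A.
Let S := boundary_in A B.
Hypothesis clB : closed (B : set (subspace A)).
Hypothesis absorbB : forall v, A v -> exists2 l : R, 0 < l & B (l *: v).
Hypothesis starB : forall v (l : R), B v -> 0 < l < 1 -> B (l *: v).
Hypothesis hypS : smooth_hypersurface N S.
Hypothesis transS : forall v, S v -> ~ tangent_space S v v.
Hypothesis reachS : forall v, B v -> v != 0 -> exists2 l : R, 0 < l & S (l^-1 *: v).

Let openA : open A. Proof. by case: conicA => _ + _ _. Qed.
Let coneA v (l : R) : A v -> 0 < l -> A (l *: v).
Proof. by case: conicA => _ _ + _; exact. Qed.

Lemma star_closed_in : exists2 C, closed C & C `&` A = B.
Proof.
have /closed_subspaceP[C cC E] := clB; exists C => //.
by rewrite E setIidl.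
Qed.

Lemma open_outside : open (A `\` B).
Proof.
have [C cC E] := star_closed_in.
have -> : A `\` B = A `&` ~` C.
  by rewrite -E; apply/seteqP; split=> x [Ax nB]; split=> // H; apply: nB;
    [split|case: H].
by apply: openI => //; exact: closed_openC.
Qed.

Lemma boundary_sub : S `<=` B.
Proof.
move=> v [[Av clv] _]; have [C cC E] := star_closed_in.
rewrite -E; split=> //; apply: cC; apply: closureS clv.
by rewrite -E => x [].
Qed.

Lemma star_interior q : B q -> ~ S q -> interior B q.
Proof.
move=> Bq nS; have Aq := BA Bq.
have ncl : ~ closure (A `\` B) q.
  by move=> cl; apply: nS; split=> //; split=> //; exact: subset_closure.
have [P nP PAB] : exists2 P, nbhs q P & ~ ((A `\` B) `&` P !=set0).
  apply: contrapT => H; apply: ncl => P nP; apply: contrapT => K.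
  by apply: H; exists P.
have nA : nbhs q A by exact: open_nbhs_nbhs.
apply: filterS2 nP nA => x Px Ax; apply: contrapT => nB.
by apply: PAB; exists x.
Qed.

(** A constant curve makes 0 a tangent vector at every point of S, so 0 in S would contradict
    transversality. *)
Lemma boundary_neq0 v : S v -> v != 0.
Proof.
move=> Sv; apply/eqP => v0; apply: (transS Sv); rewrite {2}v0.
exists 1, (cst v); split => //.
- by apply/smooth_onP => n; exact: Ck_cst.
- by rewrite derive1E derive_cst.
Qed.

(** If the radial derivative of the chart coordinate vanished at q in S, the line through f q with
    direction Df_q(q) would stay in the coordinate hyperplane; [g] would map it to a curve in S with
    velocity q, against transversality. *)
Lemma boundary_chart p : S p -> exists (U : set V) (h : V -> R),
  [/\ open U, U p, smooth_on U h, (forall q, U q -> (S q <-> h q = 0))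
    & 0 < 'D_p h p /\ forall q, U q -> S q -> 'D_q h q != 0].
Proof.
move=> Sp; have [U [W [f [i [oU Up oW [g [sf sg fg gf]] Sf]]]]] := hypS Sp.
have L : linear (fun x : 'rV[R]_N => x ord0 i : R).
  by move=> a u v; rewrite !mxE.
pose c : {linear 'rV[R]_N -> R} := HB.pack (fun x : 'rV[R]_N => x ord0 i : R)
  (GRing.isLinear.Build _ _ _ _ _ L).
have cc : continuous c by move=> x; exact: coord_continuous.
pose h := c \o f.
have sh : smooth_on U h.
  apply/smooth_onP => n; apply: Ck_post => //; move/smooth_onP: sf; exact.
have df q : U q -> differentiable f q by exact: (sf [::]).
have dh q v : U q -> 'D_v h q = c ('D_v f q).
  move=> Uq; have dcq : differentiable c (f q) by exact: linear_differentiable.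
  rewrite deriveE; last by apply: differentiable_comp dcq; exact: df.
  by rewrite diff_comp ?diff_lin//= ?deriveE//; exact: df.
have nz q : U q -> S q -> 'D_q h q != 0.
  move=> Uq Sq; apply/eqP => h0; apply: (transS Sq).
  have [Wfq gfq] := fg q Uq.
  pose w := 'D_q f q.
  have [e e0 He] := near_line w oW Wfq.
  exists e, (fun t => g (f q + t *: w)); split => //.
  - apply: (smooth_onS _ (smooth_curve (q := f q) (w := w) oW sg)) => t; exact: He.
  - move=> t te; have [Ug fgE] := gf _ (He t te).
    apply/(Sf _ Ug); rewrite fgE.
    have cw : c w = 0 by rewrite -dh.
    have cf0 : c (f q) = 0 by exact/(Sf _ Uq).
    by rewrite -[LHS]/(c (f q + t *: w)) linearD linearZZ cw cf0 scaler0 addr0.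
  - by rewrite scale0r addr0.
  - have dg : differentiable g (f q) by exact: (sg [::]).
    rewrite derive1_line// deriveE// /w deriveE; last exact: df.
    have gfid : \near q, q = (g \o f) q.
      by apply: (open_near oU Uq) => y Uy /=; case: (fg y Uy).
    have [did eid] := is_diff_id q.
    have [_] := near_eq_differentiable gfid did.
    rewrite diff_comp//; last exact: df.
    rewrite eid.
    by move=> /(congr1 (fun F : V -> V => F q)).
(* Multiplying the equation by its own radial derivative at p makes that derivative a nonzero
   square, hence positive. *)
pose s := 'D_p h p.
have s0 : s != 0 by exact: nz.
have sE q v : U q -> 'D_v (fun x => s * h x) q = s * 'D_v h q.
  move=> Uq; rewrite [LHS](@deriveZ _ _ _ h)//.
  by apply: diff_derivable; exact: (sh [::]).
exists U, (fun q => s * h q); split => //.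
- apply/smooth_onP => n; apply: CkM => //; first exact: Ck_cst.
  by move/smooth_onP: sh; exact.
- move=> q Uq; split=> [Sq|/eqP].
    have -> : h q = 0 by exact: (Sf q Uq).1.
    by rewrite mulr0.
  by rewrite mulf_eq0 (negbTE s0) /= => /eqP /(Sf q Uq).
- split; first by rewrite sE// -/s -expr2 exprn_even_gt0.
  by move=> q Uq Sq; rewrite sE// mulf_neq0// nz.
Qed.

(** On the segment from x to y every point of [B] is interior to [B], because the ball avoids S, and
    [B] is closed in [A]; connectedness carries membership from x to y. *)
Lemma star_ball x y (r : R) : ball x r y -> ball x r `<=` A ->
  (forall q, ball x r q -> ~ S q) -> B x -> B y.
Proof.
move=> xy bA bS Bx; have [C cC E] := star_closed_in.
have bt (t : R) : 0 <= t <= 1 -> ball x r (x + t *: (y - x)).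
  move=> /andP[t0 t1]; move: xy; rewrite -!ball_normE /ball_ /=.
  rewrite distrC opprD addrA subrr sub0r normrN normrZ ger0_norm//.
  by apply: le_lt_trans; rewrite ler_piMl.
have := @segment_clopen R V x (y - x) B B° C (@open_interior _ B) cC.
rewrite (addrC x) subrK; apply => //.
- by move=> t ti Bt; apply: star_interior => //; apply/bS/bt.
- by move=> t ti; exact: interior_subset.
- move=> t ti; rewrite -{1}E; split => [[]//|Ct]; split=> //; exact/bA/bt.
Qed.

Lemma boundary_ray_out v (t : R) : S v -> 1 < t -> ~ B (t *: v).
Proof.
move=> Sv t1 Bt.
have [U [h [oU Uv sh Sh [hp _]]]] := boundary_chart Sv.
have dh : differentiable h v by exact: (sh [::]).
have Av := BA (boundary_sub Sv).
have hv : h v = 0 by apply/Sh.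
have [e e0 He] := near_line v (openI oU openA) (conj Uv Av).
have D2 : 0 < 'D_v h v / 2 by rewrite divr_gt0.
(* An error of at most half the radial derivative keeps h positive at (1 + s) v for small s > 0. *)
have /nbhs_normP[d /= d0 Hd] : \forall s \near (0 : R),
    `|h (v + s *: v) - s * 'D_v h v| <= 'D_v h v / 2 * `|s|.
  have v0 := boundary_neq0 Sv.
  have e'0 : 0 < 'D_v h v / 2 / `|v| by rewrite divr_gt0// normr_gt0.
  have /nbhs_normP[d /= d0 Hd] := differentiable_eps_exp dh e'0.
  apply/nbhs_normP; exists (d / `|v|); first by rewrite /= divr_gt0// normr_gt0.
  move=> s /=; rewrite sub0r normrN ltr_pdivlMr ?normr_gt0// => sd.
  have := Hd (s *: v); rewrite /= sub0r normrN normrZ => /(_ sd).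
  rewrite hv subr0 linearZ /= -deriveE// (addrC (s *: v)).
  have -> // : 'D_v h v / 2 / `|v| * (`|s| * `|v|) = 'D_v h v / 2 * `|s|.
  by field; rewrite normr_eq0.
(* The bounds keep (1 + s) v in the chart and in [A], keep the expansion of h valid, and ensure 1 +
   s < t, so that (1 + s) v is in [B] like t v. *)
pose s := Num.min (Num.min (e / 2) (d / 2)) ((t - 1) / 2).
have s0 : 0 < s by rewrite !lt_min; apply/andP; split; [apply/andP; split|]; lra.
have se : s < e by rewrite !gt_min; apply/orP; left; apply/orP; left; lra.
have sd : s < d by rewrite !gt_min; apply/orP; left; apply/orP; right; lra.
have st : 1 + s < t.
  have : s <= (t - 1) / 2 by rewrite ge_min lexx orbT.
  lra.
have [Us As] : (U `&` A) (v + s *: v) by apply: He; rewrite gtr0_norm.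
have hs : 0 < h (v + s *: v).
  have := Hd s; rewrite /= sub0r normrN gtr0_norm// => /(_ sd).
  rewrite ler_norml => /andP[+ _].
  have : 0 < s * 'D_v h v by rewrite mulr_gt0.
  lra.
have Bs : B (v + s *: v).
  have -> : v + s *: v = ((1 + s) / t) *: (t *: v).
    by rewrite scalerA divfK ?scalerDl ?scale1r//; lra.
  apply: starB => //; rewrite divr_gt0 ?ltr_pdivrMr//=; lra.
set p := v + s *: v in Us As hs Bs.
have ch : {for p, continuous h}.
  by apply: differentiable_continuous; exact: (sh [::]).
have /nbhs_ballP[r /= r0 Hr] : nbhs p (U `&` A `&` (h @^-1` [set x | 0 < x])).
  apply: filterI; first by apply: open_nbhs_nbhs; split; [exact: openI|split].
  by apply: ch; apply: open_nbhs_nbhs; split=> //; exact: open_gt.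
have Sc : closure (A `\` B) v by case: Sv.
(* Dilation by 1 + s maps the ball of radius r / (1 + s) around v into the ball of radius r around
   p. *)
have [w [[Aw nBw] wv]] := Sc _ (nbhsx_ballx v (r / (1 + s)) (divr_gt0 r0 (addr_gt0 ltr01 s0))).
apply: nBw.
have Bw : B ((1 + s) *: w).
  apply: (@star_ball p _ r) => //.
  - move: wv; rewrite -!ball_normE /ball_ /= => wv.
    have -> : p - (1 + s) *: w = (1 + s) *: (v - w).
      by rewrite /p scalerBr [(1 + s) *: v]scalerDl scale1r.
    by rewrite normrZ gtr0_norm ?addr_gt0// mulrC -ltr_pdivlMr ?addr_gt0.
  - by move=> q /Hr[[]].
  - move=> q /Hr[[Uq _] /= hq] Sq; move: hq.
    by rewrite ((Sh q Uq).1 Sq) ltxx.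
have -> : w = (1 + s)^-1 *: ((1 + s) *: w) by rewrite scalerA mulVf ?scale1r//; lra.
by apply: starB => //; rewrite invr_gt0 invf_lt1; lra.
Qed.

Lemma boundary_on_ray v : A v -> v != 0 -> exists2 l : R, 0 < l & S (l^-1 *: v).
Proof.
move=> Av v0; have [l l0 Blv] := absorbB Av.
have [|m m0 Sm] := reachS Blv; first by rewrite scaler_eq0 negb_or gt_eqF.
exists (m / l); first exact: divr_gt0.
by rewrite invf_div mulrC -scalerA.
Qed.

Lemma star_ray p (l : R) : S p -> 0 < l -> B (l *: p) <-> l <= 1.
Proof.
move=> Sp l0; split=> [Bl|].
  by rewrite leNgt; apply/negP => l1; exact: (boundary_ray_out Sp l1).
rewrite le_eqVlt => /orP[/eqP->|l1]; first by rewrite scale1r; exact: boundary_sub.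
by apply: starB; rewrite ?l0//; exact: boundary_sub.
Qed.

Notation F := (gauge B).

(** By [star_ray] the set under the infimum is exactly the half-line from m on, so the infimum is
    attained. This is why later comparisons of F with a constant are non-strict. *)
Lemma gaugeP v (m : R) : 0 < m -> S (m^-1 *: v) -> F v = m.
Proof.
move=> m0 Sm; rewrite /gauge.
have E : [set l : R | 0 < l /\ B (l^-1 *: v)] = [set l | m <= l].
  apply/seteqP; split=> l /= => [[l0]|ml].
    have -> : l^-1 *: v = (m / l) *: (m^-1 *: v).
      by rewrite scalerA mulrAC divff ?mul1r// gt_eqF.
    by move=> /(star_ray Sm (divr_gt0 m0 l0)); rewrite ler_pdivrMr// mul1r.
  have l0 := lt_le_trans m0 ml; split=> //.
  have -> : l^-1 *: v = (m / l) *: (m^-1 *: v).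
    by rewrite scalerA mulrAC divff ?mul1r// gt_eqF.
  by apply/(star_ray Sm (divr_gt0 m0 l0)); rewrite ler_pdivrMr// mul1r.
rewrite E; apply/eqP; rewrite eq_le; apply/andP; split.
  by apply: ge_inf; [exists m|rewrite /=].
by apply: lb_le_inf; [exists m => /=|].
Qed.

Lemma gauge_boundary v : A v -> v != 0 -> 0 < F v /\ S ((F v)^-1 *: v).
Proof.
by move=> Av v0; have [l l0 Sl] := boundary_on_ray Av v0; rewrite (gaugeP l0 Sl).
Qed.

Lemma gauge0 : A 0 -> F 0 = 0.
Proof.
move=> A0; have [l l0] := absorbB A0; rewrite scaler0 => B0.
have lb : lbound [set l : R | 0 < l /\ B (l^-1 *: (0 : V))] 0.
  by move=> x [x0 _]; exact: ltW.
apply/eqP; rewrite eq_le; apply/andP; split; last first.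
  by apply: lb_le_inf => //; exists l; split; rewrite ?scaler0.
apply/ler_addgt0Pr => e e0; rewrite add0r; apply: ge_inf; first by exists 0.
by split; rewrite ?scaler0.
Qed.

Lemma gauge_positive : positive_on A F.
Proof.
move=> v Av; have [v0|v0] := eqVneq v 0.
  by move: Av; rewrite v0 => A0; rewrite gauge0.
have [Fv _] := gauge_boundary Av v0; split; first exact: ltW.
by split=> /eqP; rewrite ?gt_eqF// (negbTE v0).
Qed.

Lemma gauge_homogeneous : positively_homogeneous_on A F.
Proof.
move=> v l Av l0; have [v0|v0] := eqVneq v 0.
  by move: Av; rewrite v0 scaler0 => A0; rewrite gauge0 ?mulr0.
have [Fv Sv] := gauge_boundary Av v0; apply: gaugeP; first exact: mulr_gt0.
by rewrite invfM mulrC scalerA -mulrA mulVf ?mulr1// gt_eqF.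
Qed.

Lemma gauge_le v (c : R) : A v -> 0 < c -> F v <= c <-> B (c^-1 *: v).
Proof.
move=> Av c0; have [v0|v0] := eqVneq v 0.
  move: Av; rewrite v0 scaler0 => A0; rewrite gauge0// ltW//; split=> // _.
  by have [l l0] := absorbB A0; rewrite scaler0.
have [Fv Sv] := gauge_boundary Av v0.
have -> : c^-1 *: v = (F v / c) *: ((F v)^-1 *: v).
  by rewrite scalerA mulrAC divff ?mul1r// gt_eqF.
by rewrite star_ray ?divr_gt0// ler_pdivrMr// mul1r.
Qed.

Lemma gauge_ball : [set v | A v /\ F v <= 1] = B.
Proof.
apply/seteqP; split=> v /= => [[Av]|Bv].
  by move/(gauge_le Av ltr01); rewrite invr1 scale1r.
have Av := BA Bv; split=> //; apply/(gauge_le Av ltr01).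
by rewrite invr1 scale1r.
Qed.

Lemma gauge_sphere : [set v | A v /\ F v = 1] = S.
Proof.
apply/seteqP; split=> v /= => [[Av F1]|Sv].
  have v0 : v != 0.
    apply/eqP => v0; move: F1 Av; rewrite v0 => + A0; rewrite gauge0// => /esym/eqP.
    by rewrite oner_eq0.
  by have [_] := gauge_boundary Av v0; rewrite F1 invr1 scale1r.
split; first exact/BA/boundary_sub.
by apply: gaugeP => //; rewrite invr1 scale1r.
Qed.

Lemma gauge_continuous w0 : A w0 -> w0 != 0 -> {for w0, continuous F}.
Proof.
move=> Aw0 w00; have [Fp Sp] := gauge_boundary Aw0 w00.
have nA : \forall w \near w0, A w by exact: open_nbhs_nbhs.
have scc (c : R) : {for w0, continuous (fun w : V => c^-1 *: w)}.
  exact: scaler_continuous.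
apply/cvgrPdist_le => e e0.
have c1 : 0 < F w0 + e by exact: addr_gt0.
(* The second term keeps c positive, so that w0 / c makes sense; c < F w0 puts it in the open set A
   minus B, which gives the lower estimate for F near w0. *)
pose c := Num.max (F w0 - e) (F w0 / 2).
have c0 : 0 < c by rewrite lt_max; apply/orP; right; lra.
have cF : c < F w0 by rewrite gt_max; apply/andP; split; lra.
have ce : F w0 - e <= c by rewrite le_max lexx.
have up : \forall w \near w0, B ((F w0 + e)^-1 *: w).
  have K : F ((F w0 + e)^-1 *: w0) < 1.
    by rewrite gauge_homogeneous ?invr_gt0// mulrC ltr_pdivrMr// mul1r ltrDl.
  have : B° ((F w0 + e)^-1 *: w0).
    apply: star_interior.
      by apply/(gauge_le Aw0 c1); rewrite lerDl ltW.
    by rewrite -gauge_sphere => -[_]; move: K => /[swap] ->; rewrite ltxx.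
  exact: scc.
have lo : \forall w \near w0, (A `\` B) (c^-1 *: w).
  apply: scc; apply: open_nbhs_nbhs; split; first exact: open_outside.
  split; first by apply: coneA; rewrite ?invr_gt0.
  by move/(gauge_le Aw0 c0); rewrite leNgt cF.
apply: filterS3 nA up lo => w Aw /(gauge_le Aw c1) Fu [_ /(gauge_le Aw c0)].
move=> /negP; rewrite -ltNge => Fl.
by rewrite ler_distlC; apply/andP; split; lra.
Qed.

Lemma radial_continuous w0 : A w0 -> w0 != 0 ->
  {for w0, continuous (fun w => (F w)^-1 *: w)}.
Proof.
move=> Aw0 w00; have [Fp _] := gauge_boundary Aw0 w00.
apply: cvgZ; last exact: cvg_id.
by apply: cvgV; [rewrite gt_eqF|exact: gauge_continuous].
Qed.

(* Differentiating h (w / F w) = 0, where h is a local equation of S. *)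
Lemma gauge_differentiable w0 (U : set V) (h : V -> R) (p := (F w0)^-1 *: w0) :
  A w0 -> w0 != 0 -> open U -> U p -> differentiable h p -> 'D_p h p != 0 ->
  (forall q, U q -> S q -> h q = 0) ->
  differentiable F w0 /\ forall u, 'D_u F w0 = 'D_u h p / 'D_p h p.
Proof.
move=> Aw0 w00 oU Up dh D0 hS; have [l00 Sp] := gauge_boundary Aw0 w00.
set D := 'D_p h p in D0 *.
set l0 := F w0 in p Up dh D D0 l00 Sp *.
have [df cdf dfE] : exists2 df : {linear V -> R}, continuous df &
    forall k, D * df k = 'd h p k.
  exists (D^-1 \*: ('d h p : {linear V -> R}) : {linear V -> R}); last first.
    by move=> k; rewrite -[X in D * X]/(D^-1 * _) mulrA divff ?mul1r.
  have [k _ Hk] := linear_lipschitz (diff_continuous dh).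
  apply: (@linear_norm_bounded_continuous _ _ _ _ (`|D^-1| * k)) => x.
  by rewrite /= normrM -mulrA ler_wpM2l.
suff [dF dFE] : differentiable F w0 /\ 'd F w0 = df :> (V -> R).
  by split=> // u; rewrite deriveE// dFE deriveE// -dfE mulrAC divff ?mul1r.
apply: differentiable_eps => // e e0.
have [M M0 HM] := linear_lipschitz cdf.
have D1 : 0 < `|D| by rewrite normr_gt0.
pose m := Num.min 1 e.
have m0 : 0 < m by rewrite lt_min ltr01.
have m1 : m <= 1 by rewrite ge_min lexx.
have me : m <= e by rewrite ge_min lexx orbT.
have np : 0 <= `|p| by [].
have C0 : 0 < 1 + (M + 1) * `|p| by rewrite ltr_wpDr// mulr_ge0// addr_ge0// ltW.
(* With x the remainder and k the increment, the expansion of h gives |D| x <= d |p| x + d (1 + M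
   |p|) |k|. The factor m <= 1 lets the first term be absorbed in half of the left side; m <= e
   bounds the second by |D| / 2 times e |k|. *)
pose d := `|D| / 2 * m / (1 + (M + 1) * `|p|).
have d0 : 0 < d by rewrite divr_gt0// mulr_gt0// divr_gt0.
have dE : d * (1 + (M + 1) * `|p|) = `|D| / 2 * m by rewrite /d divfK// gt_eqF.
have nearh : \forall q \near p, `|h q - h p - 'd h p (q - p)| <= d * `|q - p|.
  have := differentiable_eps_exp dh d0.
  rewrite (near_shift p 0) sub0r.
  by apply: filterS => q /=; rewrite subrK.
have nearU : \forall q \near p, U q by exact: open_nbhs_nbhs.
have nw : \forall w \near w0, (A `\ 0) w.
  apply: open_nbhs_nbhs; split; first exact: open_punctured.
  by split=> //; exact/eqP.
have rc := radial_continuous Aw0 w00.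
have /= n1 := rc _ nearh; have /= n2 := rc _ nearU.
have : \forall w \near w0, `|F w - l0 - df (w - w0)| <= e * `|w - w0|.
  apply: filterS3 nw n1 n2 => w [Aw /eqP w0'] Hq Uq.
  have [lp Sq] := gauge_boundary Aw w0'.
  move: Hq; rewrite /= (hS _ Uq Sq) (hS _ Up Sp) subrr sub0r normrN.
  set l := F w in lp Uq Sq *; set q := l^-1 *: w in Uq Sq *; set k := w - w0.
  (* Since w = l q and w0 = l0 p, scaling by l trades the displacement of q on S for those of w and
     of F w. *)
  have Eq : l *: (q - p) = k + (l0 - l) *: p.
    rewrite scalerBr scalerA divff ?gt_eqF// scale1r scalerBl /p [l0 *: _]scalerA.
    by rewrite divff ?gt_eqF// scale1r /k addrA subrK.
  have Ed : l * 'd h p (q - p) = - D * (l - l0 - df k).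
    have Dp : 'd h p p = D by rewrite -deriveE.
    rewrite -[LHS]/(l *: _) -linearZZ Eq linearD linearZZ Dp -(dfE k).
    rewrite -[(l0 - l) *: D]/((l0 - l) * D); ring.
  move=> Hq.
  have {Hq} H1 : `|D| * `|l - l0 - df k| <= d * (`|k| + `|l - l0| * `|p|).
    rewrite -(normrN D) -normrM -Ed normrM gtr0_norm//.
    apply: le_trans (_ : l * (d * `|q - p|) <= _); first by rewrite ler_pM2l.
    rewrite mulrCA ler_pM2l//.
    have -> : l * `|q - p| = `|l *: (q - p)| by rewrite normrZ gtr0_norm.
    by rewrite Eq (distrC l) -normrZ ler_normD.
  have H2 : `|l - l0| <= `|l - l0 - df k| + M * `|k|.
    have -> : l - l0 = (l - l0 - df k) + df k by rewrite subrK.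
    by rewrite (le_trans (ler_normD _ _))// ?subrK lerD2l.
  have x0 : 0 <= `|l - l0 - df k| by exact: normr_ge0.
  set x := `|l - l0 - df k| in H1 H2 x0 *.
  set y := `|l - l0| in H1 H2; have k0 : 0 <= `|k| by [].
  have H3 : d * (y * `|p|) <= d * ((x + M * `|k|) * `|p|).
    by rewrite ler_pM2l// ler_wpM2r.
  have H4 : d * `|p| <= `|D| / 2.
    apply: le_trans (_ : d * (1 + (M + 1) * `|p|) <= _).
      rewrite ler_pM2l//; have := mulr_ge0 (ltW M0) np; lra.
    by rewrite dE ler_piMr// divr_ge0.
  have H5 : d * (1 + M * `|p|) <= `|D| / 2 * e.
    apply: le_trans (_ : d * (1 + (M + 1) * `|p|) <= _).
      rewrite ler_pM2l//; lra.
    by rewrite dE ler_wpM2l// divr_ge0.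
  have H6 := ler_wpM2r x0 H4.
  have H7 := ler_wpM2r k0 H5.
  have D2 : 0 < `|D| / 2 by rewrite divr_gt0.
  rewrite -(ler_pM2l D2); lra.
by rewrite (near_shift 0 w0) subr0; apply: filterS => k /=; rewrite addrK.
Qed.

Section Smoothness.
Variables (b : 'I_N -> V) (psi : 'I_N -> {linear V -> R}).
Hypothesis bpsi : coordinates b psi.

Lemma gauge_Ck n : Ck n (A `\ 0) F.
Proof.
have diffF x : (A `\ 0) x -> differentiable F x.
  move=> [Ax /eqP x0]; have [_ Sp] := gauge_boundary Ax x0.
  have [U [h [oU Up sh Sh [hp _]]]] := boundary_chart Sp.
  have [|||dF _ //] := gauge_differentiable (h := h) Ax x0 oU Up.
  - exact: (sh [::]).
  - by rewrite gt_eqF.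
  - by move=> q Uq /(Sh q Uq).
elim: n => [|n IH]; first exact: Ck0.
apply/CkS; split=> // v l ln x A0x.
have [Ax /eqP x0] := A0x.
have [_ Sp] := gauge_boundary Ax x0.
have [U [h [oU Up sh Sh [hp hq]]]] := boundary_chart Sp.
pose G := fun w : V => (F w)^-1 *: w.
pose O := (A `\ 0) `&` G @^-1` U.
have oO : open O.
  rewrite openE => w [[Aw /eqP w0] Uw]; apply: filterI.
    by apply: open_nbhs_nbhs; split; [exact: open_punctured|split=> //; exact/eqP].
  by apply: (radial_continuous Aw w0); exact: open_nbhs_nbhs.
have OA : O `<=` A `\ 0 by move=> w [].
(* The radial derivative D_q h q, in coordinates so that its smoothness in q is visible. [U'] is the
   part of the chart where it can be inverted. *)
pose E := fun q : V => \sum_i psi i q * 'D_(b i) h q.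
have dh q : U q -> differentiable h q by exact: (sh [::]).
have EE q : U q -> E q = 'D_q h q.
  by move=> Uq; rewrite (derive_coord bpsi)//; exact: dh.
move: sh => /smooth_onP sh.
have cE m : Ck m U E.
  apply: Ck_sum => // i; apply: CkM => //.
    by apply: Ck_lin; exact: bpsi.1.
  by have /CkS[_] := sh m.+1; exact.
pose U' := U `&` E @^-1` [set~ 0].
have oU' : open U'.
  rewrite openE => w [Uw Ew]; apply: filterI; first exact: open_nbhs_nbhs.
  have cw : {for w, continuous E}.
    by apply: differentiable_continuous; exact: (Ck_diff (cE 0)).
  apply: cw; apply: open_nbhs_nbhs; split=> //.
  by apply: closed_openC; exact: closed_eq.
have U'U : U' `<=` U by move=> w [].
have cK : Ck n U' (fun q => 'D_v h q * (E q)^-1).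
  apply: CkM => //.
    by apply: Ck_sub U'U _; have /CkS[_] := sh n.+1; exact.
  apply: CkV => //; first by move=> q [_ /eqP].
  exact: Ck_sub U'U (cE n).
have F0 w : O w -> F w != 0.
  by move=> [[Aw /eqP w0] _]; rewrite gt_eqF//; case: (gauge_boundary Aw w0).
have cG : Ck n O G.
  apply: (Ck_scale bpsi) => //; last by apply: (Ck_lin (L := idfun)) => y; exact: cvg_id.
  by apply: CkV => //; exact: Ck_sub OA IH.
have SG w : O w -> S (G w).
  by move=> [[Aw /eqP w0] _]; case: (gauge_boundary Aw w0).
have OU' w : O w -> U' (G w).
  move=> Ow; have UGw : U (G w) by case: Ow.
  by split=> //; apply/eqP; rewrite EE//; apply: hq => //; exact: SG.
have cKG := Ck_comp bpsi oO OU' cG cK.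
have Ox : O x by split.
suff : Ck n O ('D_v F) by apply.
apply: Ck_ext cKG => // w Ow; have [[Aw /eqP w0] Uw] := Ow.
have [|||_ ->] := gauge_differentiable (h := h) Aw w0 oU Uw.
- exact: dh.
- by apply: hq => //; exact: SG.
- by move=> q Uq /(Sh q Uq).
- by rewrite /= EE.
Qed.

Lemma gauge_pseudo_norm : minkowski_conic_pseudo_norm A F.
Proof.
split => //; [exact: gauge_positive|exact: gauge_homogeneous|].
by apply/smooth_onP => n; exact: gauge_Ck.
Qed.

End Smoothness.
End StarBody.

(** * Geometry of the level set F = 1 *)

Section DirectionalDerivatives.
Context {R : realType} {V : normedModType R}.

(** A homogeneous function is affine along its own ray, so Euler's identity and its second-order
    analogue are instances. *)
Lemma derive_affine {W : normedModType R} (g : V -> W) x u c d :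
  (\forall t \near (0 : R), g (x + t *: u) = c + t *: d) -> 'D_u g x = d.
Proof.
move=> H; have := nbhs_singleton H; rewrite !scale0r !addr0 => gx.
have H' : \forall t \near (0 : R)^', g (x + t *: u) = c + t *: d.
  exact: cvg_within H.
apply/lim_near_cst => //; near=> t.
rewrite /= [t *: u + x]addrC (near H' t) ?gx.
  rewrite addrC addKr scalerA mulVf ?scale1r//.
  by near: t; exact: nbhs_dnbhs_neq.
by [].
Unshelve. all: by end_near. Qed.

Lemma derive_scaled (g : V -> R) (l : R) x u : differentiable g (l *: x) ->
  'D_u (fun y => g (l *: y)) x = l * 'D_u g (l *: x).
Proof.
move=> dg; have [ds es] := is_diff_scaler l x.
have dc : differentiable (g \o *:%R l) x by exact: differentiable_comp.
rewrite [LHS](deriveE (f := g \o *:%R l))// diff_comp//= es linearZZ.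
by rewrite deriveE.
Qed.

(** Quotients from the right suffice because the derivative is known to exist; inwardness of a field
    and the triangle inequality only give bounds for t > 0. *)
Lemma derive_le_right (g : V -> R) x u (c e : R) : differentiable g x -> 0 < e ->
  (forall t, 0 < t < e -> g (x + t *: u) <= g x + t * c) -> 'D_u g x <= c.
Proof.
move=> dg e0 H.
have D : (fun h => h^-1 *: ((g \o shift x) (h *: u) - g x)) @ 0^'+ --> 'D_u g x.
  by apply: cvg_dnbhs_at_right; exact: (@diff_derivable _ _ _ g x u dg).
apply: (cvgr_to_le D); near=> t => /=.
have t0 : 0 < t by near: t; exact: nbhs_right_gt.
have te : t < e by near: t; exact: nbhs_right_lt.
rewrite [_ *: _]mulrC ler_pdivrMr// lerBlDl addrC (mulrC c).
by rewrite H ?t0.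
Unshelve. all: by end_near. Qed.

Lemma mvt_line (g : V -> R) x u :
  (forall t : R, 0 <= t <= 1 -> differentiable g (x + t *: u)) ->
  exists2 c : R, 0 < c < 1 & g (x + u) - g x = 'D_u g (x + c *: u).
Proof.
move=> dg; pose f := fun t : R => g (x + t *: u).
have df (t : R) : 0 <= t <= 1 -> differentiable f t.
  move=> ti; have [dl _] := is_diff_line x u t.
  by apply: differentiable_comp => //; exact: dg.
have derf (t : R) : 0 <= t <= 1 -> is_derive t 1 f ('D_u g (x + t *: u)).
  move=> ti; split; first exact/derivable1_diffP/df.
  have [dl el] := is_diff_line x u t; have dgt := dg t ti.
  have dft := df t ti.
  rewrite deriveE// (diff_comp (g := g) dl dgt)/= el scale1r deriveE//.
have [| |c] := @MVT R f (fun t => 'D_u g (x + t *: u)) 0 1 ltr01.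
- by move=> t; rewrite in_itv /= => /andP[t0 t1]; apply: derf; rewrite !ltW.
- apply: continuous_in_subspaceT => t; rewrite inE /= in_itv /= => ti.
  exact/differentiable_continuous/df.
- rewrite in_itv /= => ci; rewrite subr0 mulr1 /f scale1r scale0r addr0 => E.
  by exists c.
Qed.

Lemma convex_setE (X : set V) : convex_set X <->
  (forall x y (t : R), 0 <= t <= 1 -> X x -> X y -> X (t *: x + (1 - t) *: y)).
Proof.
split=> [cX x y t /andP[t0 t1] Xx Xy|cX x y l].
  have := cX x y (Itv01 t0 t1); rewrite !inE; exact.
rewrite !inE => Xx Xy; apply: cX => //.
by apply/andP; split; [exact: ge0|exact: le1].
Qed.

End DirectionalDerivatives.

(** * Derivatives of a positively homogeneous function *)

Section Minkowski.
Context {R : realType} {N : nat} {V : normedModType R} {A : set V} {F : V -> R}.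
Variables (b : 'I_N -> V) (psi : 'I_N -> {linear V -> R}).
Hypothesis bpsi : coordinates b psi.
Hypothesis mF : minkowski_conic_pseudo_norm A F.

Let openA : open A. Proof. by case: mF => -[]. Qed.
Let coneA v (l : R) : A v -> 0 < l -> A (l *: v).
Proof. by case: mF => -[_ _ + _] _ _ _; exact. Qed.
Let homF v (l : R) : A v -> 0 < l -> F (l *: v) = l * F v.
Proof. by case: mF => _ _ + _; exact. Qed.
Let smF : smooth_on (A `\ 0) F. Proof. by case: mF. Qed.

Lemma norm_ge0 v : A v -> 0 <= F v.
Proof. by case: mF => _ pF _ _ /pF[]. Qed.

Lemma norm_eq0 v : A v -> F v = 0 <-> v = 0.
Proof. by case: mF => _ pF _ _ /pF[]. Qed.

Lemma norm_gt0 v : A v -> v != 0 -> 0 < F v.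
Proof.
move=> Av v0; rewrite lt_neqAle norm_ge0// andbT eq_sym.
by apply: contra_neq v0 => /(norm_eq0 Av).
Qed.

Lemma punctured v : A v -> v != 0 -> (A `\ 0) v.
Proof. by move=> Av /eqP v0. Qed.

Lemma near_punctured v : A v -> v != 0 -> \forall w \near v, (A `\ 0) w.
Proof.
move=> Av v0; apply: open_nbhs_nbhs; split; first exact: open_punctured.
exact: punctured.
Qed.

Lemma norm_differentiable x : A x -> x != 0 -> differentiable F x.
Proof. by move=> Ax x0; apply: (smF [::]); exact: punctured. Qed.

Lemma derive_norm_differentiable u x : A x -> x != 0 -> differentiable ('D_u F) x.
Proof. by move=> Ax x0; apply: (smF [:: u]); exact: punctured. Qed.

Lemma derive_norm_linear (a : R) u w x : A x -> x != 0 ->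
  'D_(a *: u + w) F x = a * 'D_u F x + 'D_w F x.
Proof.
by move=> Ax x0; have dF := norm_differentiable Ax x0; rewrite !deriveE// linearP.
Qed.

Lemma derive_norm_add u w x : A x -> x != 0 ->
  'D_(u + w) F x = 'D_u F x + 'D_w F x.
Proof. by move=> Ax x0; rewrite -[X in X + w]scale1r derive_norm_linear// mul1r. Qed.

Lemma derive_norm_scaled_direction (a : R) u x : A x -> x != 0 ->
  'D_(a *: u) F x = a * 'D_u F x.
Proof.
by move=> Ax x0; rewrite -[a *: u]addr0 derive_norm_linear// derive0 addr0.
Qed.

Let near_gt_1 : \forall t \near (0 : R), 0 < 1 + t.
Proof.
apply/nbhs_normP; exists 1 => [|t]; rewrite /= ?ltr01// sub0r normrN ltr_norml => /andP[+ _].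
lra.
Qed.

Lemma euler v : A v -> v != 0 -> 'D_v F v = F v.
Proof.
move=> Av v0; apply: (derive_affine (c := F v)).
apply: filterS near_gt_1 => t t1.
have -> : v + t *: v = (1 + t) *: v by rewrite scalerDl scale1r.
by rewrite homF// mulrDl mul1r.
Qed.

Lemma derive_norm_scale u x (l : R) : A x -> x != 0 -> 0 < l ->
  'D_u F (l *: x) = 'D_u F x.
Proof.
move=> Ax x0 l0; have lx0 : l *: x != 0 by rewrite scaler_eq0 negb_or gt_eqF.
have dF : differentiable F (l *: x) by apply: norm_differentiable => //; exact: coneA.
have := derive_scaled u dF.
have -> : 'D_u (fun y => F (l *: y)) x = 'D_u (fun y => l * F y) x.
  apply: near_eq_derive; have := near_punctured Ax x0; apply: filterS => y [Ay _].
  exact: homF.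
rewrite [LHS](@deriveZ _ _ _ F)/=; last first.
  by apply: diff_derivable; exact: norm_differentiable.
by move=> /(mulfI _) ->//; rewrite gt_eqF.
Qed.

(** Only the quadratic form: the fundamental tensor and the second fundamental form are tested on
    pairs of equal vectors. *)
Definition hess x u : R := 'D_u ('D_u F) x.

Lemma hess_scale u x (l : R) : A x -> x != 0 -> 0 < l ->
  hess x u = l * hess (l *: x) u.
Proof.
move=> Ax x0 l0; have lx0 : l *: x != 0 by rewrite scaler_eq0 negb_or gt_eqF.
rewrite /hess -derive_scaled; last by apply: derive_norm_differentiable => //; exact: coneA.
apply: near_eq_derive; have := near_punctured Ax x0; apply: filterS => y [Ay /eqP y0].
by rewrite derive_norm_scale.
Qed.

(** The sum is dF_q(Y q), and this is its Leibniz rule. It is applied to tangent fields and, with Y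
    the identity, to Euler's identity. *)
Lemma derive_along_field (Y : V -> V) x y : A x -> x != 0 -> differentiable Y x ->
  differentiable (fun q => \sum_i psi i (Y q) * 'D_(b i) F q) x /\
  'D_y (fun q => \sum_i psi i (Y q) * 'D_(b i) F q) x =
    'D_('D_y Y x) F x + 'D_y ('D_(Y x) F) x.
Proof.
move=> Ax x0 dY.
have dpsi i : differentiable (psi i \o Y) x.
  by apply: differentiable_comp => //; apply: linear_differentiable; exact: bpsi.1.
have dDF i := derive_norm_differentiable (b i) Ax x0.
pose f i : V -> R := fun q => psi i (Y q) * 'D_(b i) F q.
have df i : differentiable (f i) x.
  exact: (differentiableM (dpsi i) (dDF i)).
have E : (fun q => \sum_i psi i (Y q) * 'D_(b i) F q) = \sum_(i < N) f i.
  by apply/funext => q; rewrite fct_sumE.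
rewrite E; split; first exact: differentiable_sum.
rewrite derive_sum; last by move=> i; exact: diff_derivable.
have fE i : 'D_y (f i) x =
    psi i ('D_y Y x) * 'D_(b i) F x + psi i (Y x) * 'D_y ('D_(b i) F) x.
  rewrite [LHS](@deriveM _ _ (psi i \o Y) ('D_(b i) F)); try exact: diff_derivable.
  rewrite addrC; congr (_ + _); rewrite [_ *: _]mulrC; congr (_ * _).
  have dp : differentiable (psi i) (Y x).
    by apply: linear_differentiable; exact: bpsi.1.
  rewrite deriveE// diff_comp//= diff_lin; last exact: bpsi.1.
  by rewrite deriveE.
rewrite (eq_bigr _ (fun i _ => fE i)) big_split /=; congr (_ + _).
  by rewrite -(derive_coord bpsi)//; exact: norm_differentiable.
pose g i : V -> R := fun q => psi i (Y x) * 'D_(b i) F q.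
have gE i : 'D_y (g i) x = psi i (Y x) * 'D_y ('D_(b i) F) x.
  by rewrite [LHS](@deriveZ _ _ _ ('D_(b i) F))//; exact: diff_derivable.
have dg i : derivable (g i) x y.
  by apply: (@derivableZ _ _ _ ('D_(b i) F)); exact: diff_derivable.
rewrite -(eq_bigr _ (fun i _ => gE i)) -derive_sum//.
apply: near_eq_derive; have := near_punctured Ax x0; apply: filterS => q [Aq /eqP q0].
rewrite fct_sumE (derive_coord bpsi)//; exact: norm_differentiable.
Qed.

(** The radial vector is killed in each slot separately: in the outer one because D_u F is
    homogeneous of degree 0, in the inner one by differentiating dF_q(q) = F q. No symmetry of
    second derivatives enters. *)
Lemma hess_radial_decomposition x (a : R) w : A x -> x != 0 ->
  hess x (a *: x + w) = hess x w.
Proof.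
move=> Ax x0.
have r1 u : 'D_x ('D_u F) x = 0.
  apply: (derive_affine (c := 'D_u F x)); apply: filterS near_gt_1 => t t1.
  have -> : x + t *: x = (1 + t) *: x by rewrite scalerDl scale1r.
  by rewrite derive_norm_scale// scaler0 addr0.
have r2 u : 'D_u ('D_x F) x = 0.
  have [did _] := is_diff_id x.
  have [_] := derive_along_field (Y := id) u Ax x0 did.
  rewrite derive_id.
  have -> : 'D_u (fun q => \sum_i psi i (id q) * 'D_(b i) F q) x = 'D_u F x.
    apply: near_eq_derive; have := near_punctured Ax x0.
    apply: filterS => q [Aq /eqP q0].
    by rewrite -(derive_coord bpsi) ?euler//; exact: norm_differentiable.
  by rewrite -[X in X = _]addr0 => /addrI.
rewrite /hess.
have -> : 'D_(a *: x + w) ('D_(a *: x + w) F) x =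
          'D_(a *: x + w) (a *: 'D_x F + 'D_w F) x.
  apply: near_eq_derive; have := near_punctured Ax x0; apply: filterS => q [Aq /eqP q0].
  by rewrite derive_norm_linear.
have dx := derive_norm_differentiable x Ax x0.
have dw := derive_norm_differentiable w Ax x0.
rewrite deriveD; [|by apply: derivableZ; exact: diff_derivable|exact: diff_derivable].
rewrite deriveZ; last exact: diff_derivable.
rewrite r2 scaler0 add0r deriveE// linearP /= -!deriveE//.
by rewrite r1 scaler0 add0r.
Qed.

Lemma fundamental_tensorE v u : A v -> v != 0 ->
  fundamental_tensor F v u u = 'D_u F v ^+ 2 + F v * hess v u.
Proof.
move=> Av v0; rewrite /fundamental_tensor.
pose k := fun q => F q * 'D_u F q.
have dk : differentiable k v.
  apply: differentiableM; first exact: norm_differentiable.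
  exact: derive_norm_differentiable.
have [e e0 He] := near_line u (open_punctured openA) (punctured Av v0).
have E : \forall t \near (0 : R),
    derive1 (fun s : R => 2^-1 * F (v + t *: u + s *: u) ^+ 2) 0 = k (v + t *: u).
  apply/nbhs_normP; exists e => // t /=; rewrite sub0r normrN => /He[Aq /eqP q0].
  have dF := norm_differentiable Aq q0.
  rewrite (@derive1_line R V R (v + t *: u) u (fun q => 2^-1 * F q ^+ 2)); last first.
    have -> : (fun q => 2^-1 * F q ^+ 2) = 2^-1 *: F ^+ 2 by [].
    exact/differentiableZ/differentiableX.
  have -> : (fun q => 2^-1 * F q ^+ 2) = 2^-1 *: F ^+ 2 by [].
  rewrite deriveZ; last by apply: derivableX; exact: diff_derivable.
  rewrite deriveX; last exact: diff_derivable.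
  rewrite expr1 [LHS]mulrA -[_ *+ 2]mulr_natl mulrA mulVf// mul1r.
  by rewrite /k.
rewrite derive1E (near_eq_derive _ E) -derive1E (@derive1_line R V R v u k)//.
rewrite [LHS](@deriveM _ _ F ('D_u F)).
- by rewrite addrC expr2.
- by apply: diff_derivable; exact: norm_differentiable.
- by apply: diff_derivable; exact: derive_norm_differentiable.
Qed.

(** * Unit ball, unit sphere and second fundamental form *)

Section IndicatrixBall.
Variables (B S : set V).
Hypothesis BE : forall v, B v <-> A v /\ F v <= 1.
Hypothesis SE : forall v, S v <-> A v /\ F v = 1.

Lemma sphere_mem v : S v -> A v. Proof. by move/SE => []. Qed.

Lemma sphere_norm v : S v -> F v = 1. Proof. by move/SE => []. Qed.

Lemma sphere_neq0 v : S v -> v != 0.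
Proof.
move=> /SE[Av F1]; apply/eqP => v0; move/(norm_eq0 Av): v0; rewrite F1 => /eqP.
by rewrite oner_eq0.
Qed.

Lemma sphere_normalize v : A v -> v != 0 -> S ((F v)^-1 *: v).
Proof.
move=> Av v0; have Fv := norm_gt0 Av v0; apply/SE; split.
  by apply: coneA; rewrite ?invr_gt0.
by rewrite homF ?invr_gt0// mulVf// gt_eqF.
Qed.

(** For the converse, the line p + t u is pushed radially onto S; as dF_p(u) = 0, the factor 1 / F
    has zero derivative at p along u and the velocity remains u. *)
Lemma tangent_sphere p u : S p -> tangent_space S p u <-> 'D_u F p = 0.
Proof.
move=> Sp; have Ap := sphere_mem Sp; have p0 := sphere_neq0 Sp.
have dF := norm_differentiable Ap p0.
split=> [[e [c [e0 sc Sc c0 c1]]]|Du0].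
  have dc : differentiable c 0 by apply: (sc [::]); rewrite /= normr0.
  have dFc : differentiable (F \o c) 0.
    by apply: differentiable_comp => //; rewrite c0.
  have E : derive1 (F \o c) 0 = 'D_u F p.
    rewrite derive1E' // diff_comp//=; last by rewrite c0.
    by rewrite -derive1E'// c1 c0 deriveE.
  rewrite -E derive1E; transitivity ('D_1 (cst 1 : R -> R) (0 : R));
    last by rewrite derive_cst.
  apply: near_eq_derive.
  apply/nbhs_normP; exists e => // t /=; rewrite sub0r normrN => /Sc.
  exact: sphere_norm.
pose g := fun q : V => (F q)^-1 *: q.
have sg : smooth_on (A `\ 0) g.
  apply/smooth_onP => n; apply: (Ck_scale bpsi); first exact: open_punctured.
    apply: CkV; first exact: open_punctured.
      by move=> q [Aq /eqP q0]; rewrite gt_eqF// norm_gt0.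
    by move/smooth_onP: smF; exact.
  by apply: (Ck_lin (L := idfun)) => y; exact: cvg_id.
have [e e0 He] := near_line u (open_punctured openA) (punctured Ap p0).
exists e, (fun t => g (p + t *: u)); split => //.
- apply: (smooth_onS _ (smooth_curve (q := p) (w := u) (open_punctured openA) sg)).
  by move=> t; exact: He.
- by move=> t /He[Aq /eqP q0]; exact: sphere_normalize.
- by rewrite scale0r addr0 /g (sphere_norm Sp) invr1 scale1r.
- have dg : differentiable g p by apply: (sg [::]); exact: punctured.
  rewrite derive1_line//.
  have Fp0 : F p != 0 by rewrite (sphere_norm Sp) oner_eq0.
  rewrite (bpsi.2 ('D_u g p)) [RHS](bpsi.2 u); apply: eq_bigr => i _; congr (_ *: _).
  have dpsi x : differentiable (psi i) x.
    by apply: linear_differentiable; exact: bpsi.1.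
  have -> : psi i ('D_u g p) = 'D_u (psi i \o g) p.
    rewrite [RHS]deriveE; last exact: differentiable_comp.
    by rewrite diff_comp//= diff_lin ?deriveE//; exact: bpsi.1.
  have -> : psi i \o g = (fun q => (F q)^-1 * psi i q).
    by apply/funext => q /=; rewrite linearZ.
  rewrite [LHS](@deriveM _ _ (fun q => (F q)^-1) (psi i)).
  - rewrite deriveV//; last exact: diff_derivable.
    rewrite Du0 scaler0 scaler0 addr0 (sphere_norm Sp) invr1 scale1r.
    by rewrite deriveE// diff_lin//; exact: bpsi.1.
  - by apply: derivableV => //; exact: diff_derivable.
  - exact: diff_derivable.
Qed.

Lemma derive_vanishing_on_sphere p u (m : V -> R) : S p -> 'D_u F p = 0 ->
  differentiable m p -> (\forall q \near p, S q -> m q = 0) -> 'D_u m p = 0.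
Proof.
move=> Sp Du0 dm m0.
have [e [c [e0 sc Sc c0 c1]]] := (tangent_sphere u Sp).2 Du0.
have dc : differentiable c 0 by apply: (sc [::]); rewrite /= normr0.
have dmc : differentiable (m \o c) 0.
  by apply: differentiable_comp => //; rewrite c0.
have E : derive1 (m \o c) 0 = 'D_u m p.
  rewrite derive1E' // diff_comp//=; last by rewrite c0.
  by rewrite -derive1E'// c1 c0 deriveE.
rewrite -E derive1E; transitivity ('D_1 (cst 0 : R -> R) (0 : R));
  last by rewrite derive_cst.
apply: near_eq_derive.
have nU : \forall t \near (0 : R), S (c t) -> m (c t) = 0.
  have cc := differentiable_continuous dc.
  rewrite -c0 in m0; exact: (cc [set q | S q -> m q = 0] m0).
have nS : \forall t \near (0 : R), S (c t).
  by apply/nbhs_normP; exists e => // t /=; rewrite sub0r normrN => /Sc.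
by apply: filterS2 nU nS => t mc Sct; exact: mc.
Qed.

(** The function q |-> dF_q(Y q) vanishes on S near p, hence so does its derivative along a tangent
    vector; the Leibniz rule splits that derivative. *)
Lemma derive_tangent_field p u Y : S p -> 'D_u F p = 0 ->
  tangent_field_near S p Y ->
  'D_('D_u Y p) F p = - 'D_u ('D_(Y p) F) p.
Proof.
move=> Sp Du0 [U [oU Up sY YT]].
have Ap := sphere_mem Sp; have p0 := sphere_neq0 Sp.
have dY : differentiable Y p by exact: (sY [::]).
have [dm Em] := derive_along_field u Ap p0 dY.
apply/eqP; rewrite -addr_eq0 -Em; apply/eqP.
apply: derive_vanishing_on_sphere => //.
apply: (open_near oU Up) => q Uq Sq.
rewrite -(derive_coord bpsi); first by apply/(tangent_sphere _ Sq); exact: YT.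
by apply: norm_differentiable; [exact: sphere_mem|exact: sphere_neq0].
Qed.

(** Applying dF_p to the decomposition kills the tangent part and determines s, so [xget] chooses
    from at most one value; an explicit tangent field shows that there is one. *)
Lemma second_fundamental_formE xi p u : S p -> 'D_u F p = 0 ->
  'D_(xi p) F p != 0 ->
  second_fundamental_form S xi p u u = - hess p u / 'D_(xi p) F p.
Proof.
move=> Sp Du0 xi0; have Ap := sphere_mem Sp; have p0 := sphere_neq0 Sp.
have dF := norm_differentiable Ap p0.
apply: xget_subset1; last first.
  move=> s s' [Y [Z [TY Yp TZ YZ]]] [Y' [Z' [TY' Yp' TZ' YZ']]].
  have K (s0 : R) (Y0 Z0 : V -> V) : tangent_field_near S p Y0 -> Y0 p = u ->
      tangent_space S p (Z0 p) -> 'D_u Y0 p = Z0 p + s0 *: xi p ->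
      s0 * 'D_(xi p) F p = - hess p u.
    move=> T0 Y0p TZ0 E0.
    have := derive_tangent_field Sp Du0 T0; rewrite Y0p -/(hess p u) => <-.
    move/(tangent_sphere _ Sp): TZ0 => Z00.
    by rewrite E0 addrC derive_norm_linear// Z00 addr0.
  apply: (mulIf xi0).
  by rewrite (K s Y Z)// (K s' Y' Z').
(* [Y] is the constant field u projected to ker dF_q along q, using dF_q(q) = F q; at p nothing is
   subtracted. *)
pose k := fun q => - ('D_u F q / F q).
pose Y := fun q => u + k q *: q.
have sY : smooth_on (A `\ 0) Y.
  have oA := open_punctured openA.
  move/smooth_onP: smF => smF'.
  apply/smooth_onP => n; apply: CkD => //; first exact: Ck_cst.
  apply: (Ck_scale bpsi) => //; last first.
    by apply: (Ck_lin (L := idfun)) => y; exact: cvg_id.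
  have K : Ck n (A `\ 0) (fun q => (-1) * ('D_u F q * (F q)^-1)).
    apply: CkM => //; first exact: Ck_cst.
    apply: CkM => //; first by have /CkS[_] := smF' n.+1; exact.
    by apply: CkV => // q [Aq /eqP q0]; rewrite gt_eqF// norm_gt0.
  by apply: Ck_ext K => // q _; rewrite mulN1r.
have TY : tangent_field_near S p Y.
  exists (A `\ 0); split => //; [exact: open_punctured|exact: punctured|].
  move=> q [Aq /eqP q0] Sq; apply/(tangent_sphere _ Sq).
  rewrite /Y addrC derive_norm_linear// euler// /k mulNr divfK ?addNr//.
  by rewrite gt_eqF// norm_gt0.
have Yp : Y p = u by rewrite /Y /k Du0 mul0r oppr0 scale0r addr0.
pose s := - hess p u / 'D_(xi p) F p.
exists Y, (fun=> 'D_u Y p - s *: xi p); split => //.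
  apply/(tangent_sphere _ Sp).
  rewrite addrC -scaleNr derive_norm_linear//.
  rewrite (derive_tangent_field Sp Du0 TY) Yp -/(hess p u) /s.
  by rewrite mulNr divfK// opprK subrr.
by rewrite subrK.
Qed.

Lemma mem_interior_ball v : A v -> v != 0 -> F v < 1 -> interior B v.
Proof.
move=> Av v0 Fv.
have cF := differentiable_continuous (norm_differentiable Av v0).
have n1 : \forall w \near v, F w < 1.
  by apply: (cF [set y | y < 1]); apply: open_nbhs_nbhs; split.
apply: filterS2 n1 (near_punctured Av v0) => w Fw [Aw _].
by apply/BE; split=> //; exact: ltW.
Qed.

Lemma sphere_not_interior v : S v -> ~ interior B v.
Proof.
move=> Sv iB; have Av := sphere_mem Sv.
have [e e0 He] := near_line v (@open_interior _ B) iB.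
have e2 : 0 < e / 2 by rewrite divr_gt0.
have /interior_subset /BE[_] : B° (v + (e / 2) *: v).
  by apply: He; rewrite gtr0_norm// ltr_pdivrMr// mulr_natr mulr2n ltrDl.
have -> : v + (e / 2) *: v = (1 + e / 2) *: v by rewrite scalerDl scale1r.
by rewrite homF ?addr_gt0// (sphere_norm Sv) mulr1 gerDl leNgt e2.
Qed.

Lemma inward_radial : inward_transverse_field B S (fun v => - v).
Proof.
split=> [p Sp|v Sv].
  exists setT, -%R; split => //; first exact: openT.
  apply/smooth_onP => n.
  have L : linear (fun x : V => - x) by move=> a x y; rewrite opprD scalerN.
  pose c : {linear V -> V} := HB.pack (fun x : V => - x)
    (GRing.isLinear.Build _ _ _ _ _ L).
  by apply: (Ck_lin (L := c)) => y; exact: oppr_continuous.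
have Av := sphere_mem Sv; have v0 := sphere_neq0 Sv; split.
  move/(tangent_sphere _ Sv); rewrite -scaleN1r -[_ *: v]addr0 derive_norm_linear//.
  rewrite derive0 euler// (sphere_norm Sv) mulr1 addr0 => /eqP.
  by rewrite oppr_eq0 oner_eq0.
exists 1 => // t /andP[t0 t1]; rewrite scalerN -scaleNr -[X in X + _]scale1r -scalerDl.
have t1' : 0 < 1 - t by rewrite subr_gt0.
apply: mem_interior_ball; first exact: coneA.
  by rewrite scaler_eq0 negb_or gt_eqF.
by rewrite homF// (sphere_norm Sv) mulr1 gtrBl.
Qed.

(** F <= 1 just inside gives a nonpositive derivative, and a zero derivative would make xi
    tangent. *)
Lemma inward_derive_lt0 xi p : inward_transverse_field B S xi -> S p ->
  'D_(xi p) F p < 0.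
Proof.
move=> [_ H] Sp; have [nT [e e0 He]] := H p Sp.
have Ap := sphere_mem Sp; have p0 := sphere_neq0 Sp.
rewrite lt_neqAle; apply/andP; split.
  by apply/eqP => D0; apply: nT; apply/(tangent_sphere _ Sp).
apply: (derive_le_right (norm_differentiable Ap p0) e0) => t te.
have /interior_subset/BE[_] := He t te.
by rewrite mulr0 addr0 (sphere_norm Sp).
Qed.

Lemma second_fundamental_form_sign xi p u : inward_transverse_field B S xi ->
  S p -> 'D_u F p = 0 -> exists2 a : R, 0 < a &
  second_fundamental_form S xi p u u = a * hess p u.
Proof.
move=> xiP Sp Du0; have xi0 := inward_derive_lt0 xiP Sp.
exists (- ('D_(xi p) F p))^-1; first by rewrite invr_gt0 oppr_gt0.
by rewrite second_fundamental_formE// ?lt_eqF// invrN !mulNr mulrC.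
Qed.

Lemma strongly_convex_hypersurfaceP xi : inward_transverse_field B S xi ->
  strongly_convex_hypersurface S xi <->
  (forall p u, S p -> 'D_u F p = 0 -> u != 0 -> 0 < hess p u).
Proof.
move=> xiP; split=> [H p u Sp Du0 u0|H p Sp u].
  have := H p Sp u ((tangent_sphere u Sp).2 Du0) u0.
  by have [a a0 ->] := second_fundamental_form_sign xiP Sp Du0; rewrite pmulr_rgt0.
move=> /(tangent_sphere u Sp) Du0 u0.
by have [a a0 ->] := second_fundamental_form_sign xiP Sp Du0; rewrite pmulr_rgt0// H.
Qed.

Lemma convex_hypersurfaceP xi : inward_transverse_field B S xi ->
  convex_hypersurface S xi <->
  (forall p u, S p -> 'D_u F p = 0 -> 0 <= hess p u).
Proof.
move=> xiP; split=> [H p u Sp Du0|H p Sp u].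
  have := H p Sp u ((tangent_sphere u Sp).2 Du0).
  by have [a a0 ->] := second_fundamental_form_sign xiP Sp Du0; rewrite pmulr_rge0.
move=> /(tangent_sphere u Sp) Du0.
by have [a a0 ->] := second_fundamental_form_sign xiP Sp Du0; rewrite pmulr_rge0// H.
Qed.

Lemma radial_decomposition x u : A x -> x != 0 -> exists (a : R) (w : V),
  u = a *: x + w /\ 'D_w F x = 0.
Proof.
move=> Ax x0; exists ('D_u F x / F x), (u - ('D_u F x / F x) *: x).
rewrite subrKC; split=> //.
rewrite addrC -scaleNr derive_norm_linear// euler// mulNr divfK ?addNr//.
by rewrite gt_eqF// norm_gt0.
Qed.

Lemma hess_normalize x u : A x -> x != 0 ->
  hess x u = (F x)^-1 * hess ((F x)^-1 *: x) u.
Proof. by move=> Ax x0; apply: hess_scale; rewrite // invr_gt0 norm_gt0. Qed.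

Lemma derive_normalize x u : A x -> x != 0 ->
  'D_u F ((F x)^-1 *: x) = 'D_u F x.
Proof. by move=> Ax x0; apply: derive_norm_scale; rewrite // invr_gt0 norm_gt0. Qed.

Lemma minkowski_conic_normP :
  minkowski_conic_norm A F <->
  (forall p u, S p -> 'D_u F p = 0 -> u != 0 -> 0 < hess p u).
Proof.
split=> [[_ H] p u Sp Du0 u0|H].
  have Ap := sphere_mem Sp; have p0 := sphere_neq0 Sp.
  have := H p Ap p0 u u0; rewrite fundamental_tensorE// Du0 (sphere_norm Sp).
  by rewrite expr0n add0r mul1r.
split=> // v Av v0 u u0; rewrite fundamental_tensorE//.
have [a [w [uE Dw0]]] := radial_decomposition u Av v0.
have Fv := norm_gt0 Av v0.
(* The Hessian sees only w. For w = 0 positivity has to come from the square of dF_v(u) = a F v. *)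
have [w0|w0] := eqVneq w 0.
  have a0 : a != 0 by apply: contra_neq u0 => a0; rewrite uE w0 a0 scale0r addr0.
  have Eu : 'D_u F v = a * F v by rewrite uE derive_norm_linear// euler// Dw0 addr0.
  have -> : hess v u = 0 by rewrite uE hess_radial_decomposition// w0 /hess derive0.
  by rewrite mulr0 addr0 exprn_even_gt0//= Eu mulf_neq0// gt_eqF.
rewrite ltr_wpDl ?sqr_ge0// uE hess_radial_decomposition// hess_normalize//.
rewrite mulrA divff ?mul1r ?gt_eqF//; apply: H => //; first exact: sphere_normalize.
by rewrite derive_normalize.
Qed.

(** Since dF_x(x) = F x, this is the usual support inequality F y >= F x + dF_x(y - x) of a convex
    function. *)
Definition gradient_inequality : Prop :=
  forall x y, A x -> x != 0 -> A y -> 'D_y F x <= F y.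

Lemma conic_norm_gradient : conic_norm A F -> gradient_inequality.
Proof.
move=> [_ _ _ _ tri] x y Ax x0 Ay.
apply: (derive_le_right (norm_differentiable Ax x0) ltr01) => t /andP[t0 _].
by rewrite -(homF Ay t0); apply: tri => //; exact: coneA.
Qed.

(** * Convex domains: triangle inequality, convex balls, convex hypersurfaces *)

Section ConvexDomain.
Hypothesis convA : convex_set A.

Lemma cone_add v w : A v -> A w -> A (v + w).
Proof.
move=> Av Aw.
have -> : v + w = 2 *: (2^-1 *: v + (1 - 2^-1) *: w).
  have -> : 1 - 2^-1 = 2^-1 :> R by field.
  by rewrite scalerDr !scalerA mulfV// !scale1r.
apply: coneA => //; move/convex_setE: convA; apply => //.
by apply/andP; split; lra.
Qed.

Lemma domain_full : A 0 -> forall v, A v.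
Proof.
move=> A0 v; have [e e0 He] := near_line v openA A0.
have e2 : 0 < e / 2 by rewrite divr_gt0.
have := He (e / 2); rewrite gtr0_norm// ltr_pdivrMr// mulr_natr mulr2n ltrDl.
move=> /(_ e0); rewrite add0r => /coneA/(_ (_ : 0 < (e / 2)^-1)).
by rewrite scalerA mulVf ?scale1r ?gt_eqF//; apply; rewrite invr_gt0.
Qed.

Lemma norm0 : A 0 -> F 0 = 0. Proof. by move=> /norm_eq0 ->. Qed.

Lemma gradient_conic_norm : gradient_inequality -> conic_norm A F.
Proof.
move=> GI; have [cA pF hF _] := mF; split => // v w Av Aw.
have Avw := cone_add Av Aw.
have [vw0|vw0] := eqVneq (v + w) 0.
  by rewrite vw0 norm0 -?vw0// addr_ge0// norm_ge0.
rewrite -{1}(euler Avw vw0) derive_norm_add//.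
by apply: lerD; exact: GI.
Qed.

(** Two mean values along u = y - x: F y - F x is D_u F at an intermediate point, and D_u F has not
    decreased on the way there because its derivative is a positive multiple of the Hessian. *)
Lemma hess_gradient :
  (forall x u, A x -> x != 0 -> 0 <= hess x u) -> gradient_inequality.
Proof.
move=> H x y Ax x0 Ay; pose u := y - x.
have yE : y = x + u by rewrite /u subrKC.
have Au (t : R) : 0 <= t <= 1 -> A (x + t *: u).
  move=> ti; have -> : x + t *: u = t *: y + (1 - t) *: x.
    by rewrite /u scalerBr scalerBl scale1r addrCA.
  by move/convex_setE: convA; exact.
(* If the segment meets 0, then y is a nonpositive multiple of x, and dF_x(y) <= 0 <= F y by Euler's
   identity. *)
have [[t [ti xt0]]|nz] := pselect (exists t : R, 0 <= t <= 1 /\ x + t *: u = 0).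
  have t0 : t != 0 by apply: contra_neq x0 => t0; rewrite -xt0 t0 scale0r addr0.
  have -> : y = - ((1 - t) / t) *: x + 0.
    apply: (scalerI t0); rewrite addr0 scalerA mulrN mulrCA mulfV// mulr1.
    apply/eqP; rewrite -subr_eq0 scaleNr opprK -xt0 /u scalerBr scalerBl scale1r.
    by rewrite addrCA.
  rewrite derive_norm_linear// euler// derive0 addr0 (@le_trans _ _ 0)//.
    rewrite mulNr oppr_le0 mulr_ge0 ?norm_ge0// divr_ge0//.
      by rewrite subr_ge0; case/andP: ti.
    by case/andP: ti.
  rewrite addr0; apply: norm_ge0.
  have -> : - ((1 - t) / t) *: x = y.
    apply: (scalerI t0); rewrite scalerA mulrN mulrCA mulfV// mulr1.
    apply/eqP; rewrite -subr_eq0 scaleNr -opprD oppr_eq0 -xt0 /u scalerBr scalerBl scale1r.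
    by rewrite addrCA addrC.
  by [].
have nz' (t : R) : 0 <= t <= 1 -> x + t *: u != 0.
  by move=> ti; apply/eqP => xt0; apply: nz; exists t.
have [c /andP[c0 c1] Ec] := @mvt_line _ _ F x u (fun t ti =>
  norm_differentiable (Au t ti) (nz' t ti)).
have cle (t : R) : 0 <= t <= 1 -> 0 <= t * c <= 1.
  move=> /andP[t0 t1]; have c0' := ltW c0; have c1' := ltW c1.
  by rewrite mulr_ge0//= mulr_ile1.
have ds (t : R) : 0 <= t <= 1 -> differentiable ('D_u F) (x + t *: (c *: u)).
  move=> /cle ti; rewrite scalerA.
  by apply: derive_norm_differentiable; [exact: Au|exact: nz'].
have [d /andP[d0 d1] Ed] := mvt_line ds.
have dcu : 0 <= 'D_(c *: u) ('D_u F) (x + d *: (c *: u)).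
  have di : 0 <= d <= 1 by rewrite !ltW.
  rewrite deriveE; last exact: ds.
  rewrite linearZ /= -deriveE; last exact: ds.
  apply: mulr_ge0; first exact: ltW.
  have dc := cle _ di.
  by rewrite scalerA; apply: H; [exact: Au|exact: nz'].
have : 'D_u F x <= F (x + u) - F x.
  by rewrite Ec -subr_ge0 Ed.
rewrite -yE => Du; rewrite {1}yE derive_norm_add// euler//.
by lra.
Qed.

(** Adding the inequalities for (x, z) and (z, x) makes dF monotone. With z = x + t u, D_u F does
    not drop below its value at x for small t > 0. *)
Lemma gradient_hess : gradient_inequality ->
  forall x u, A x -> x != 0 -> 0 <= hess x u.
Proof.
move=> GI x u Ax x0.
have mono z : A z -> z != 0 -> 'D_(z - x) F x <= 'D_(z - x) F z.
  move=> Az z0; have := GI x z Ax x0 Az; have := GI z x Az z0 Ax.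
  have E q : A q -> q != 0 -> 'D_(z - x) F q = 'D_z F q - 'D_x F q.
    move=> Aq q0; rewrite addrC -scaleN1r derive_norm_linear// mulN1r addrC.
    by [].
  by rewrite !E// euler// euler//; lra.
have [e e0 He] := near_line u (open_punctured openA) (punctured Ax x0).
have dD := derive_norm_differentiable u Ax x0.
rewrite -oppr_le0 /hess -deriveN; last exact: diff_derivable.
apply: (derive_le_right _ e0); first exact: differentiableN.
move=> t /andP[t0 te]; rewrite mulr0 addr0.
have [Az /eqP z0] : (A `\ 0) (x + t *: u) by apply: He; rewrite gtr0_norm.
have := mono _ Az z0; rewrite addrAC subrr add0r.
rewrite !derive_norm_scaled_direction// ler_pM2l//.
by move=> ?; rewrite lerN2.
Qed.

Lemma hess_sphere_ge0 :
  (forall p u, S p -> 'D_u F p = 0 -> 0 <= hess p u) ->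
  forall x u, A x -> x != 0 -> 0 <= hess x u.
Proof.
move=> H x u Ax x0.
have [a [w [-> Dw0]]] := radial_decomposition u Ax x0.
rewrite hess_radial_decomposition// hess_normalize// mulr_ge0 ?invr_ge0 ?norm_ge0//.
by apply: H; [exact: sphere_normalize|rewrite derive_normalize].
Qed.

Lemma conic_norm_convex_hypersurface xi : inward_transverse_field B S xi ->
  conic_norm A F <-> convex_hypersurface S xi.
Proof.
move=> xiP; split=> [cn|/(convex_hypersurfaceP xiP) H].
  apply/(convex_hypersurfaceP xiP) => p u Sp _.
  by apply: (gradient_hess (conic_norm_gradient cn)); [exact: sphere_mem|exact: sphere_neq0].
exact/gradient_conic_norm/hess_gradient/hess_sphere_ge0.
Qed.

Lemma norm_homogeneous_ge0 v (l : R) : A v -> 0 <= l -> A (l *: v) -> F (l *: v) = l * F v.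
Proof.
move=> Av; rewrite le_eqVlt => /orP[/eqP<-|l0 _]; last exact: homF.
by rewrite scale0r mul0r; exact: norm0.
Qed.

Lemma weight_normalize v (s : R) : A v -> v != 0 ->
  (F v / s) *: ((F v)^-1 *: v) = s^-1 *: v.
Proof.
by move=> Av v0; rewrite scalerA mulrAC mulfV ?mul1r// gt_eqF// norm_gt0.
Qed.

(** For the converse, (v + w) / (F v + F w) is the convex combination of the normalized v and w with
    weights F v / (F v + F w) and F w / (F v + F w). *)
Lemma conic_norm_convex_ball : conic_norm A F <-> convex_set B.
Proof.
split=> [[_ _ _ _ tri]|/convex_setE cB].
  apply/convex_setE => x y t ti /BE[Ax Fx] /BE[Ay Fy].
  have Az : A (t *: x + (1 - t) *: y) by move/convex_setE: convA; exact.
  (* The end points are set aside: [A] is stable only under positive factors, and 0 need not belong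
     to it. *)
  move: ti Az => /andP[]; rewrite le_eqVlt => /orP[/eqP<- _ _|t0].
    by rewrite scale0r add0r subr0 scale1r; exact/BE.
  rewrite le_eqVlt => /orP[/eqP-> _|t1 Az].
    by rewrite subrr scale0r addr0 scale1r; exact/BE.
  have t1' : 0 < 1 - t by rewrite subr_gt0.
  apply/BE; split=> //; apply: le_trans (tri _ _ (coneA Ax t0) (coneA Ay t1')) _.
  rewrite !homF//; have := ler_wpM2l (ltW t0) Fx; have := ler_wpM2l (ltW t1') Fy.
  lra.
have [cA pF hF _] := mF; split => // v w Av Aw.
have [v0|v0] := eqVneq v 0; first by rewrite {1}v0 add0r lerDr norm_ge0.
have [w0|w0] := eqVneq w 0; first by rewrite {1}w0 addr0 lerDl norm_ge0.
have Fv := norm_gt0 Av v0; have Fw := norm_gt0 Aw w0.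
have Fvw : 0 < F v + F w by exact: addr_gt0.
have Bn x : A x -> x != 0 -> B ((F x)^-1 *: x).
  move=> Ax x0; apply/BE; have /SE[? ->] := sphere_normalize Ax x0.
  by split.
have := cB _ _ (F v / (F v + F w)) _ (Bn v Av v0) (Bn w Aw w0).
have -> : 1 - F v / (F v + F w) = F w / (F v + F w) by field; rewrite gt_eqF.
rewrite !weight_normalize// -scalerDr.
have ti : 0 <= F v / (F v + F w) <= 1.
  apply/andP; split; first by rewrite ltW// divr_gt0.
  by rewrite ler_pdivrMr// mul1r lerDl ltW.
move=> /(_ ti) /BE[_]; rewrite homF ?invr_gt0//; last exact: cone_add.
by rewrite mulrC ler_pdivrMr// mul1r.
Qed.

Lemma proportional_sphere x y (l : R) : 0 <= l -> S x -> S y -> x = l *: y -> x = y.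
Proof.
move=> l0 Sx Sy E; move: (sphere_norm Sx).
rewrite E norm_homogeneous_ge0 -?E//; [|exact: sphere_mem|exact: sphere_mem].
by rewrite (sphere_norm Sy) mulr1 => l1; rewrite E l1 scale1r.
Qed.

(** A combination z with F z >= 1 forces F u = F v = 1 and equality in the triangle inequality, so u
    and v lie on one ray and coincide. The premise on the origin covers z = 0, where continuity of F
    is not yet known. *)
Lemma strict_norm_strict_ball : (A 0 -> interior B 0) ->
  conic_norm_strict A F -> strictly_convex_set B.
Proof.
move=> int0 [[_ _ _ _ tri] str] u v /BE[Au Fu] /BE[Av Fv] uv l /andP[l0 l1].
have l1' : 0 < 1 - l by rewrite subr_gt0.
have Alu := coneA Au l0; have Alv := coneA Av l1'.
have Az := cone_add Alu Alv.
set z := _ + _ in Az *.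
have [z0|z0] := eqVneq z 0; first by rewrite z0; apply: int0; rewrite -z0.
have H1 := ler_wpM2l (ltW l0) Fu; have H2 := ler_wpM2l (ltW l1') Fv.
have H3 := tri _ _ Alu Alv; rewrite -/z !homF// in H3.
have [Fz|Fz] := ltP (F z) 1; first exact: mem_interior_ball.
have Fu1 : F u = 1.
  have : l * 1 <= l * F u by lra.
  by rewrite ler_pM2l// => Fu'; apply/eqP; rewrite eq_le Fu.
have Fv1 : F v = 1.
  have : (1 - l) * 1 <= (1 - l) * F v by lra.
  by rewrite ler_pM2l// => Fv'; apply/eqP; rewrite eq_le Fv.
have Su : S u by exact/SE.
have Sv : S v by exact/SE.
have [|k k0 E] := str _ _ Alu Alv.
  rewrite -/z !homF//; apply/eqP; rewrite eq_le H3/= Fu1 Fv1 !mulr1 addrC subrK.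
  exact: Fz.
exfalso; move/eqP: uv; apply; case: E => E.
  apply: (proportional_sphere (l := l^-1 * (k * (1 - l)))) => //.
    by rewrite !mulr_ge0 ?invr_ge0// ltW.
  by rewrite -scalerA -scalerA -E scalerA mulVf ?scale1r// gt_eqF.
apply/esym; apply: (proportional_sphere (l := (1 - l)^-1 * (k * l))) => //.
  by rewrite !mulr_ge0 ?invr_ge0// ltW.
by rewrite -scalerA -scalerA -E scalerA mulVf ?scale1r// gt_eqF.
Qed.

(** Equality for v, w on different rays would place (v + w) / (F v + F w) both on S and, by strict
    convexity, in the interior of [B]. *)
Lemma strict_ball_strict_norm : strictly_convex_set B -> conic_norm_strict A F.
Proof.
move=> sB; split.
  apply/conic_norm_convex_ball/convex_setE => x y t /andP[].
  rewrite le_eqVlt => /orP[/eqP<- _|t0]; first by rewrite scale0r add0r subr0 scale1r.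
  rewrite le_eqVlt => /orP[/eqP-> |t1 Bx By].
    by rewrite subrr scale0r addr0 scale1r.
  have [->|xy] := eqVneq x y; first by rewrite -scalerDl addrC subrK scale1r.
  by apply: interior_subset; apply: sB => //; rewrite t0.
move=> v w Av Aw E.
have [->|v0] := eqVneq v 0; first by exists 0 => //; left; rewrite scale0r.
have [->|w0] := eqVneq w 0; first by exists 0 => //; right; rewrite scale0r.
have Fv := norm_gt0 Av v0; have Fw := norm_gt0 Aw w0.
have Fvw : 0 < F v + F w by exact: addr_gt0.
have [vw|vw] := eqVneq ((F v)^-1 *: v) ((F w)^-1 *: w).
  exists (F v / F w); first by rewrite divr_ge0// ltW.
  by left; rewrite -scalerA -vw scalerA mulfV ?scale1r// gt_eqF.
have Sv := sphere_normalize Av v0; have Sw := sphere_normalize Aw w0.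
have SB x : S x -> B x by move=> /SE[Ax Fx]; apply/BE; rewrite Fx.
have := sB _ _ (SB _ Sv) (SB _ Sw) vw (F v / (F v + F w)).
have -> : 1 - F v / (F v + F w) = F w / (F v + F w) by field; rewrite gt_eqF.
rewrite !weight_normalize// -scalerDr.
have ti : 0 < F v / (F v + F w) < 1.
  by rewrite divr_gt0//= ltr_pdivrMr// mul1r ltrDl.
move=> /(_ ti) iB; exfalso; apply: sphere_not_interior iB.
apply/SE; have Avw := cone_add Av Aw; split.
  by apply: coneA; rewrite ?invr_gt0.
by rewrite homF ?invr_gt0// E mulVf// gt_eqF.
Qed.

(** A point x of [B] in the tangent hyperplane has dF_v0(x) = 1, so F x = 1; then dF_v0(v0 + x) = 2
    bounds F (v0 + x) from below and forces equality in the triangle inequality. *)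
Lemma strict_norm_strict_hypersurface :
  conic_norm_strict A F -> strictly_convex_hypersurface B S.
Proof.
move=> [cn str] v0 Sv0; have GI := conic_norm_gradient cn.
have [_ _ _ _ tri] := cn.
have Av0 := sphere_mem Sv0; have v00 := sphere_neq0 Sv0; have F1 := sphere_norm Sv0.
apply/seteqP; split=> x /=; last first.
  move=> ->; split; last by apply/BE; rewrite F1.
  by exists 0; rewrite ?addr0//; apply/(tangent_sphere _ Sv0); rewrite derive0.
move=> [[u /(tangent_sphere _ Sv0) Du0 <-] /BE[Ax Fx]].
have D1 : 'D_(v0 + u) F v0 = 1.
  by rewrite derive_norm_add// euler// F1 Du0 addr0.
have Fx1 : F (v0 + u) = 1.
  by apply/eqP; rewrite eq_le Fx/= -D1; exact: GI.
have A2 := cone_add Av0 Ax.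
have [|k k0 E] := str _ _ Av0 Ax.
  apply/eqP; rewrite eq_le tri//= F1 Fx1.
  have := GI v0 _ Av0 v00 A2.
  by rewrite derive_norm_add// euler// F1 D1.
have Sx : S (v0 + u) by exact/SE.
by case: E => E; [apply/esym|]; apply: proportional_sphere k0 _ _ E.
Qed.

(** The gradient inequality is obtained together with its equality case. Equality in the triangle
    inequality makes both gradient inequalities at v + w equalities, so v and w are nonnegative
    multiples of v + w. *)
Lemma strict_hypersurface_strict_norm :
  strictly_convex_hypersurface B S -> conic_norm_strict A F.
Proof.
move=> sS.
have onS p y : S p -> A y -> 0 < 'D_y F p ->
    'D_y F p <= F y /\ ('D_y F p = F y -> y = 'D_y F p *: p).
  move=> Sp Ay Dy; have Ap := sphere_mem Sp; have p0 := sphere_neq0 Sp.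
  set d := 'D_y F p in Dy *.
  (* Division by d puts y on the hyperplane tangent at p; if F y <= d it also lies in [B], hence
     equals p. *)
  have touch : F y <= d -> y = d *: p.
    move=> Fy; have : ([set p + u | u in tangent_space S p] `&` B) (d^-1 *: y).
      split.
        exists (d^-1 *: y - p); last by rewrite subrKC.
        apply/(tangent_sphere _ Sp); rewrite derive_norm_linear// -scaleN1r.
        rewrite -[-1 *: p]addr0 derive_norm_linear// derive0 euler//.
        by rewrite (sphere_norm Sp) -/d mulVf ?gt_eqF// mulr1 addr0 subrr.
      apply/BE; split; first by apply: coneA; rewrite ?invr_gt0.
      by rewrite homF ?invr_gt0// mulrC ler_pdivrMr// mul1r.
    rewrite (sS p Sp) /= => <-.
    by rewrite scalerA mulfV ?scale1r// gt_eqF.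
  split; last by move=> E; apply: touch; rewrite E.
  rewrite leNgt; apply/negP => Fy; have yE := touch (ltW Fy).
  by move: Fy; rewrite {1}yE homF// (sphere_norm Sp) mulr1 ltxx.
have GI' x y : A x -> x != 0 -> A y -> 'D_y F x <= F y /\
    ('D_y F x = F y -> exists2 k : R, 0 <= k & y = k *: x).
  move=> Ax x0 Ay; have Sp := sphere_normalize Ax x0.
  rewrite -derive_normalize//.
  have [Dy|Dy] := ltP 0 ('D_y F ((F x)^-1 *: x)).
    have [le eq] := onS _ _ Sp Ay Dy; split=> // /eq ->.
    exists ('D_y F ((F x)^-1 *: x) / F x); last by rewrite scalerA.
    by rewrite divr_ge0// ltW// norm_gt0.
  split; first by apply: le_trans Dy _; exact: norm_ge0.
  move=> E; have Fy0 : F y = 0 by apply/eqP; rewrite eq_le norm_ge0// andbT -E.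
  by exists 0 => //; move/(norm_eq0 Ay): Fy0 => ->; rewrite scale0r.
have GI : gradient_inequality.
  by move=> x y Ax x0 Ay; case: (GI' x y Ax x0 Ay).
split; first exact: gradient_conic_norm.
move=> v w Av Aw E; have Avw := cone_add Av Aw.
have [v0|v0] := eqVneq v 0; first by exists 0 => //; left; rewrite v0 scale0r.
have [vw0|vw0] := eqVneq (v + w) 0.
  have := norm_gt0 Av v0; have := norm_ge0 Aw; move: E.
  by rewrite vw0 norm0 -?vw0// => E; lra.
have [le1 eq1] := GI' _ v Avw vw0 Av; have [le2 eq2] := GI' _ w Avw vw0 Aw.
have E' : 'D_v F (v + w) + 'D_w F (v + w) = F v + F w.
  by rewrite -E -(euler Avw vw0) derive_norm_add.
have [k k0 Ek] : exists2 k : R, 0 <= k & v = k *: (v + w) by apply: eq1; lra.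
have [m m0 Em] : exists2 k : R, 0 <= k & w = k *: (v + w) by apply: eq2; lra.
have kn0 : k != 0 by apply: contra_neq v0 => k00; rewrite Ek k00 scale0r.
exists (m / k); first exact: divr_ge0.
by right; rewrite {1}Em {2}Ek scalerA divfK.
Qed.

End ConvexDomain.

(** * Full domains and spheres *)

Section FullDomain.
Variables (phi : {linear 'rV[R]_N -> V}) (rho : {linear V -> 'rV[R]_N}).
Hypotheses (phiK : cancel phi rho) (rhoK : cancel rho phi).
Hypotheses (cphi : continuous phi) (crho : continuous rho).

Let phi_eq0 x : (phi x == 0) = (x == 0).
Proof.
apply/eqP/eqP => [p0|->]; last by rewrite linear0.
by rewrite -(phiK x) p0 linear0.
Qed.

Let rho_eq0 v : (rho v == 0) = (v == 0).
Proof. by rewrite -phi_eq0 rhoK. Qed.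

(** The maximum of F over the image of the unit sphere, which avoids 0, spreads by homogeneity; this
    controls F at the origin, where smoothness says nothing. The added 1 keeps the constant
    positive. *)
Lemma norm_le_multiple : A = setT -> exists2 M : R, 0 < M & forall v, F v <= M * `|v|.
Proof.
move=> AT; have Aall v : A v by rewrite AT.
have F0 : F 0 = 0 by exact: norm0.
have [k k0 Hk] := linear_lipschitz crho.
have [[x0 x0N]|N0] := pselect (exists x : 'rV[R]_N, x != 0); last first.
  exists 1 => // v; suff -> : v = 0 by rewrite F0 normr0 mulr0.
  by apply/eqP/negP => /negP v0; apply: N0; exists (rho v); rewrite rho_eq0.
pose K := [set x : 'rV[R]_N | `|x| = 1].
have [|||c /= Kc cmax] := @EVT_max_rV R N (F \o phi) K.
- by exists (`|x0|^-1 *: x0); rewrite /K /= normrZ normfV normr_id mulVf ?normr_eq0.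
- exact: unit_sphere_compact.
- apply: continuous_in_subspaceT => x; rewrite inE => Kx.
  have x1 : x != 0 by rewrite -normr_eq0 (Kx : `|x| = 1) oner_eq0.
  apply: continuous_comp; first exact: cphi.
  by apply/differentiable_continuous/norm_differentiable; rewrite ?phi_eq0.
exists ((F (phi c) + 1) * k); first by rewrite mulr_gt0// ltr_wpDl// norm_ge0.
move=> v; have [->|v0] := eqVneq v 0; first by rewrite F0 normr0 mulr0.
have r0 : 0 < `|rho v| by rewrite normr_gt0 rho_eq0.
have := cmax (`|rho v|^-1 *: rho v).
rewrite inE /K /= normrZ normfV normr_id mulVf ?gt_eqF// => /(_ erefl).
rewrite linearZ /= rhoK homF ?invr_gt0// mulrC ler_pdivrMr// => Hv.
apply: le_trans Hv _; rewrite -mulrA; apply: ler_pM => //.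
  exact: norm_ge0.
by rewrite lerDl.
Qed.

Lemma full_domain_origin : A = setT -> interior B 0 /\ {for 0, continuous F}.
Proof.
move=> AT; have Aall v : A v by rewrite AT.
have [M M0 HM] := norm_le_multiple AT.
have near0 (e : R) : 0 < e -> \forall v \near (0 : V), F v <= e.
  move=> e0; apply/nbhs_normP; exists (e / M); first by rewrite /= divr_gt0.
  move=> v /=; rewrite sub0r normrN ltr_pdivlMr// => /ltW H.
  by apply: le_trans (HM v) _; rewrite mulrC.
split; first by have := near0 1 ltr01; apply: filterS => v Fv; apply/BE.
apply/cvgrPdist_le => e e0; have := near0 e e0; apply: filterS => v Fv.
by rewrite norm0// sub0r normrN ger0_norm// norm_ge0.
Qed.

Let sqnorm (x : 'rV[R]_N) : R := \sum_(i < N) x ord0 i ^+ 2.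

Let sqnorm_continuous : continuous sqnorm.
Proof.
move=> x; apply: differentiable_continuous.
have -> : sqnorm = \sum_(i < N) (fun x : 'rV[R]_N => x ord0 i ^+ 2).
  by apply/funext => y; rewrite fct_sumE.
apply: differentiable_sum => i.
exact: (differentiableX 1 (differentiable_coord x ord0 i)).
Qed.

Let sqnorm_ge0 x : 0 <= sqnorm x.
Proof. by apply: sumr_ge0 => i _; exact: sqr_ge0. Qed.

Let sqnormZ (a : R) x : sqnorm (a *: x) = a ^+ 2 * sqnorm x.
Proof. by rewrite /sqnorm mulr_sumr; apply: eq_bigr => i _; rewrite mxE exprMn. Qed.

Let sqnorm_gt0 x : x != 0 -> 0 < sqnorm x.
Proof.
move=> x0; rewrite lt_neqAle sqnorm_ge0 andbT eq_sym.
apply: contra_neq x0 => /eqP; rewrite psumr_eq0 => [/allP H|i _]; last exact: sqr_ge0.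
apply/rowP => i; rewrite mxE; apply/eqP.
by have := H i (mem_index_enum i); rewrite sqrf_eq0.
Qed.

(** Radial projection in both directions: dividing by F lands on S, dividing by the Euclidean norm
    of the coordinates lands on the sphere. *)
Lemma full_domain_homeomorphic : A = setT -> homeomorphic_sets S (@euclidean_sphere R N).
Proof.
move=> AT; have Aall v : A v by rewrite AT.
pose r (x : 'rV[R]_N) := Num.sqrt (sqnorm x).
have r0 x : x != 0 -> 0 < r x by move=> /sqnorm_gt0; rewrite sqrtr_gt0.
have rZ (a : R) x : 0 <= a -> r (a *: x) = a * r x.
  by move=> a0; rewrite /r sqnormZ sqrtrM ?sqr_ge0// sqrtr_sqr ger0_norm.
have cr : continuous r.
  by move=> x; apply: continuous_comp; [exact: sqnorm_continuous|exact: sqrt_continuous].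
have sphereE x : euclidean_sphere x <-> sqnorm x = 1 by [].
have sphere_r x : euclidean_sphere x -> r x = 1 by move=> /sphereE E; rewrite /r E sqrtr1.
have sphere0 (x : 'rV[R]_N) : euclidean_sphere x -> x != 0.
  move=> /sphere_r rx; apply/eqP => x0; move: rx; rewrite x0 -(scale0r x) rZ// mul0r.
  by move=> /esym/eqP; rewrite oner_eq0.
exists (fun v => (r (rho v))^-1 *: rho v), (fun y => (F (phi y))^-1 *: phi y).
split.
- apply: continuous_in_subspaceT => v; rewrite inE => Sv.
  have v0 : rho v != 0 by rewrite rho_eq0 sphere_neq0.
  apply: cvgZ; last exact: crho.
  apply: cvgV; first by rewrite gt_eqF// r0.
  by apply: continuous_comp; [exact: crho|exact: cr].
- apply: continuous_in_subspaceT => y; rewrite inE => Sy.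
  have y0 : phi y != 0 by rewrite phi_eq0 sphere0.
  have cG : {for phi y, continuous (fun v : V => (F v)^-1 *: v)}.
    apply: cvgZ; last exact: cvg_id.
    apply: cvgV; first by rewrite gt_eqF// norm_gt0.
    exact/differentiable_continuous/norm_differentiable.
  have H : continuous_at y (fun z : 'rV[R]_N => (F (phi z))^-1 *: phi z).
    apply: (continuous_comp (f := phi) (g := fun v : V => (F v)^-1 *: v)) => //.
    exact: cphi.
  exact: H.
- move=> v Sv; have v0 : rho v != 0 by rewrite rho_eq0 sphere_neq0.
  have rv := r0 _ v0; split.
    apply/sphereE; rewrite sqnormZ exprVn sqr_sqrtr ?mulVf//.
    by rewrite gt_eqF// sqnorm_gt0.
  rewrite linearZ /= rhoK homF ?invr_gt0// (sphere_norm Sv) mulr1 invrK.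
  by rewrite scalerA mulfV ?scale1r// gt_eqF.
- move=> y Sy; have y0 : phi y != 0 by rewrite phi_eq0 sphere0.
  split; first exact: sphere_normalize.
  have Fy := norm_gt0 (Aall _) y0.
  rewrite linearZ /= phiK rZ ?invr_ge0 ?norm_ge0// (sphere_r _ Sy) mulr1 invrK.
  by rewrite scalerA mulfV ?scale1r// gt_eqF.
Qed.

Lemma euclidean_sphere_compact : compact (@euclidean_sphere R N).
Proof.
apply: bounded_closed_compact.
  exists 1; split=> // M M1 x Sx /=.
  rewrite [leLHS]/Num.norm /= mx_normrE; apply: bigmax_le => [|[i j] _ /=].
    by rewrite ltW// (lt_trans ltr01).
  rewrite (le_trans _ (ltW M1))// (ord1 i) -(@ler_pXn2r _ 2) ?nnegrE//.
  rewrite expr1n -normrX ger0_norm ?sqr_ge0// -[leRHS](Sx : sqnorm x = 1).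
  rewrite /sqnorm (bigD1 j)//= lerDl; apply: sumr_ge0 => k _; exact: sqr_ge0.
apply: (preimage_closed (f := sqnorm) (D := [set 1])).
  by move=> x _; exact: sqnorm_continuous.
exact: closed_eq.
Qed.

(* Compactness of S makes the set of directions of A closed, so that A is
   relatively closed in the complement of the origin. *)
Lemma compact_sphere_closure q : compact S -> q != 0 -> closure A q -> A q.
Proof.
move=> cS q0 clq; apply: contrapT => nAq.
pose n := fun v : V => `|v|^-1 *: v.
have cn v : v != 0 -> {for v, continuous n}.
  move=> v0; apply: cvgZ; last exact: cvg_id.
  by apply: cvgV; [rewrite normr_eq0|exact: norm_continuous].
have clP : closed (n @` S).
  apply: compact_closed; first exact: norm_hausdorff.
  apply: continuous_compact => //; apply: continuous_in_subspaceT => v; rewrite inE => Sv.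
  exact/cn/sphere_neq0.
have AP v : v != 0 -> A v -> (n @` S) (n v).
  move=> v0 Av; exists ((F v)^-1 *: v); first exact: sphere_normalize.
  have Fv := norm_gt0 Av v0.
  rewrite /n normrZ normfV gtr0_norm// invfM invrK scalerA mulrAC mulfV ?mul1r//.
  by rewrite gt_eqF.
have PA v : v != 0 -> (n @` S) (n v) -> A v.
  move=> v0 [s Ss E].
  have -> : v = (`|v| / `|s|) *: s.
    by rewrite -scalerA -[`|s|^-1 *: s]/(n s) E /n scalerA mulfV ?scale1r// normr_eq0.
  by apply: coneA; [exact: sphere_mem|rewrite divr_gt0// normr_gt0// sphere_neq0].
have nP : \forall v \near q, (~` (n @` S)) (n v).
  apply: (cn _ q0); apply: open_nbhs_nbhs; split; first exact: closed_openC.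
  by move=> /(PA _ q0).
have n0 : \forall v \near q, v != 0.
  have H : open (~` [set (0 : V)]).
    exact/closed_openC/accessible_closed_set1/hausdorff_accessible/norm_hausdorff.
  by apply: (open_near H) => [/eqP|v /eqP]; rewrite ?(negbTE q0).
have [v [Av [nPv v0]]] := clq _ (filterI nP n0).
by apply: nPv; exact: AP.
Qed.

Lemma compact_sphere_segment x y : compact S -> A x ->
  (forall t : R, 0 <= t <= 1 -> x + t *: (y - x) != 0) -> A y.
Proof.
move=> cS Ax nz.
have := @segment_clopen R V x (y - x) A A (closure A) openA (@closed_closure _ A).
rewrite subrKC; apply => // t ti; split; first exact: subset_closure.
exact/compact_sphere_closure/nz.
Qed.

Lemma homeomorphic_full_domain : (0 < N)%N ->
  homeomorphic_sets S (@euclidean_sphere R N) -> A = setT.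
Proof.
move=> N0 [f [g [cf cg fg gf]]].
have cS : compact S.
  have -> : S = g @` (@euclidean_sphere R N).
    apply/seteqP; split=> [v Sv|v [y Sy <-]]; last by case: (gf y Sy).
    by have [Sf gfv] := fg v Sv; exists (f v).
  exact: continuous_compact cg euclidean_sphere_compact.
have [A0|nA0] := pselect (A 0).
  by apply/seteqP; split=> // v _; exact: domain_full.
(* By the convention on conic domains, containing every nonzero vector would put 0 in [A], which
   this case excludes. *)
have [[_ _ _ A0'] _ _ _] := mF.
suff An0 v : v != 0 -> A v by case: nA0; exact: A0'.
move=> v0.
have [a Aa] : A !=set0 by case: mF => -[].
have a0 : a != 0 by apply/eqP => a0; apply: nA0; rewrite -a0.
(* The i-th coordinate along the segment is 1 - t times that of x, so 0 could only occur at the end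
   point y. *)
have seg x y i : rho x ord0 i != 0 -> rho y ord0 i = 0 -> y != 0 ->
    forall t : R, 0 <= t <= 1 -> x + t *: (y - x) != 0.
  move=> xi yi y0 t _; apply/eqP => E.
  have Ei : (1 - t) * rho x ord0 i = 0.
    have := congr1 (fun z => rho z ord0 i) E.
    by rewrite linearD linearZ linearB /= linear0 !mxE yi sub0r mulrN mulrBl mul1r.
  have t1 : t = 1.
    by apply/eqP; move/eqP: Ei; rewrite mulf_eq0 (negbTE xi) orbF subr_eq0 eq_sym.
  by move: E y0; rewrite t1 scale1r subrKC => ->; rewrite eqxx.
have nz w : w != 0 -> exists i, rho w ord0 i != 0.
  rewrite -rho_eq0 => w0; apply: contrapT => H; move/eqP: w0; apply.
  by apply/rowP => i; rewrite mxE; apply/eqP/negP => /negP ri; apply: H; exists i.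
have [i ai] := nz a a0.
(* With a second coordinate, the j-th basis vector w has zero i-th coordinate and serves as a relay
   from a to v. *)
have [[j ji]|one] := pselect (exists j : 'I_N, j != i).
  pose w := phi (delta_mx 0 j).
  have wE k : rho w ord0 k = (k == j)%:R by rewrite phiK mxE eqxx.
  have w0 : w != 0.
    apply/eqP => w0; have := wE j; rewrite w0 linear0 mxE eqxx => /esym/eqP.
    by rewrite oner_eq0.
  have wi : rho w ord0 i = 0 by rewrite wE eq_sym (negbTE ji).
  have Aw : A w by apply: (compact_sphere_segment cS Aa); exact: seg ai wi w0.
  have [vi|vi] := eqVneq (rho v ord0 i) 0.
    by apply: (compact_sphere_segment cS Aa); exact: seg ai vi v0.
  apply: (compact_sphere_segment cS Aw) => t ti.
  (* [seg] wants the end point with zero i-th coordinate last, so the segment is read backwards. *)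
  have -> : w + t *: (v - w) = v + (1 - t) *: (w - v).
    rewrite !scalerBr !scalerBl !scale1r opprB.
    by rewrite [X in _ = v + X]addrC [RHS]addrA [v + (_ - v)]addrC subrK addrCA.
  apply: seg vi wi w0 _ _.
  by case/andP: ti => t0 t1; apply/andP; split; lra.
(* Dimension 1: the sphere is {e, -e}. The two image points in S are distinct, hence on opposite
   rays, and v lies on one of these rays. *)
have all_i k : k = i by apply/eqP/negP => /negP ki; apply: one; exists k.
pose c w := rho w ord0 i.
have cE x y : y != 0 -> x = (c x / c y) *: y.
  move=> y0; have cy : c y != 0 by have [k] := nz y y0; rewrite (all_i k).
  rewrite -[LHS]rhoK -[RHS]rhoK linearZ /=; congr (phi _); apply/rowP => k.
  by rewrite (all_i k) mxE divfK.
pose e : 'rV[R]_N := const_mx 1.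
have sum1 (x : 'rV[R]_N) : sqnorm x = x ord0 i ^+ 2.
  by rewrite /sqnorm (bigD1 i)//= big1 ?addr0// => k; rewrite (all_i k) eqxx.
have Se : @euclidean_sphere R N e.
  by rewrite /euclidean_sphere /= -/(sqnorm e) sum1 mxE expr1n.
have Sme : @euclidean_sphere R N (- e).
  by rewrite /euclidean_sphere /= -/(sqnorm (- e)) sum1 !mxE sqrrN expr1n.
have [S1 f1] := gf _ Se; have [S2 f2] := gf _ Sme.
have neq : g e <> g (- e).
  move=> E; move: f1; rewrite E f2 => /rowP/(_ i); rewrite !mxE; lra.
have cn x : x != 0 -> c x != 0 by move=> /nz[k]; rewrite (all_i k).
have h1 := sphere_neq0 S1; have h2 := sphere_neq0 S2.
have n1 := cn _ h1; have n2 := cn _ h2; have nv := cn _ v0.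
have opp : c (g e) / c (g (- e)) < 0.
  rewrite ltNge; apply/negP => H; apply: neq.
  exact: proportional_sphere H S1 S2 (cE _ _ h2).
have [H|H] := ltP 0 (c v / c (g e)).
  by rewrite (cE v _ h1); apply: coneA => //; exact: sphere_mem.
rewrite (cE v _ h2); apply: coneA; first exact: sphere_mem.
have -> : c v / c (g (- e)) = (c v / c (g e)) * (c (g e) / c (g (- e))).
  by rewrite mulrA divfK.
rewrite nmulr_lgt0//; rewrite lt_neqAle H andbT mulf_neq0//.
by rewrite invr_eq0.
Qed.

End FullDomain.
End IndicatrixBall.
End Minkowski.

Theorem theorem2p14 (R : realType) (N : nat) (V : normedModType R)
  (A B : set V) :
  (1 <= N)%N ->
  has_dimension N V ->
  conic_domain A ->
  B `<=` A ->
  let S := boundary_in A B in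
  (* (a1) *)
  closed (B : set (subspace A)) ->
  (forall v, A v -> exists2 l : R, 0 < l & B (l *: v)) ->
  (* (a2) *)
  (forall v (l : R), B v -> 0 < l < 1 -> B (l *: v)) ->
  (* (a3) *)
  smooth_hypersurface N S ->
  closed (S : set (subspace A)) ->
  (forall v, S v -> ~ tangent_space S v v) ->
  (* (a4) *)
  (forall v, B v -> v != 0 -> exists2 l : R, 0 < l & S (l^-1 *: v)) ->
  let F := gauge B in
  [/\ minkowski_conic_pseudo_norm A F,
      [set v | A v /\ F v <= 1] = B,
      (* (i) *)
      (minkowski_pseudo_norm A F <->
         homeomorphic_sets S (@euclidean_sphere R N)) /\
      (minkowski_pseudo_norm A F ->
         interior B 0 /\ {for 0, continuous F}),
      (* the quantifications over xi below are not void *)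
      inward_transverse_field B S (fun v => - v) /\
      (* (ii) *)
      (forall xi : V -> V, inward_transverse_field B S xi ->
         (minkowski_conic_norm A F <-> strongly_convex_hypersurface S xi))
    & convex_set A ->
      (* (iii) *)
      [/\ conic_norm A F <-> convex_set B,
          (forall xi : V -> V, inward_transverse_field B S xi ->
             (conic_norm A F <-> convex_hypersurface S xi)),
      (* (iv) *)
          conic_norm_strict A F <-> strictly_convex_set B
        & conic_norm_strict A F <-> strictly_convex_hypersurface B S]].
Proof.
move=> N0 dimV conicA BA S clB absorbB starB hypS _ transS reachS F.
have [b [psi bpsi]] := has_coordinates dimV.
have [phi [rho [phiK rhoK cphi crho]]] := has_dimension_coord dimV.
have mF : minkowski_conic_pseudo_norm A F by exact: gauge_pseudo_norm bpsi.
have ballE : [set v | A v /\ F v <= 1] = B by exact: (@gauge_ball R N).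
have BE v : B v <-> A v /\ F v <= 1 by rewrite -{1}ballE.
have SE v : S v <-> A v /\ F v = 1.
  have <- : [set v | A v /\ F v = 1] = S by exact: (@gauge_sphere R N).
  by [].
have full := full_domain_origin mF BE phiK rhoK cphi crho.
split => //.
- split; last by case=> _; exact: full.
  split=> [[_ AT]|hS]; first exact: (full_domain_homeomorphic mF SE phiK rhoK cphi crho).
  by split=> //; exact: (homeomorphic_full_domain mF SE phiK rhoK).
- split; first exact: (inward_radial bpsi mF BE SE).
  move=> xi xiP; apply: iff_trans (minkowski_conic_normP bpsi mF SE) _.
  exact: (iff_sym (strongly_convex_hypersurfaceP bpsi mF BE SE xiP)).
- move=> cA.
  (* An open cone containing 0 is the whole space, where F is bounded by a multiple of the auxiliary
     norm. *)
  have int0 : A 0 -> interior B 0.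
    move=> A0; suff AT : A = setT by case: (full AT).
    by apply/seteqP; split=> // v _; exact: (domain_full mF A0 v).
  split.
  + exact: (conic_norm_convex_ball mF BE SE).
  + by move=> xi xiP; exact: (conic_norm_convex_hypersurface bpsi mF BE SE).
  + split; first exact: (strict_norm_strict_ball mF BE SE).
    exact: (strict_ball_strict_norm mF BE SE).
  + split; first exact: (strict_norm_strict_hypersurface bpsi mF BE SE).
    exact: (strict_hypersurface_strict_norm bpsi mF BE SE).
Qed.
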